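(* Let $F$ be an infinite field with $\operatorname{char}F\ne2$, and let $I$ be the $T_{\mathbb{Z}_3}$-ideal of $\mathbb{Z}_3$-graded identities of $UT_3(F)^{(-)}$ with its canonical grading. Then every $T_{\mathbb{Z}_3}$-ideal $J$ with $I\subseteq J$ is finitely generated as a $T_{\mathbb{Z}_3}$-ideal.
   Context: $UT_3(F)^{(-)}$ is the Lie algebra of $3\times3$ upper triangular matrices with bracket $[a,b]=ab-ba$, with canonical $\mathbb{Z}_3$-grading (degree-$k$ component spanned by $e_{ij}$ with $j-i=k$). The free Lie algebra is generated by countably many variables $y_i$ of degree $0$, $z_i$ of degree $1$, $w_i$ of degree $2$, with the induced grading. A $T_{\mathbb{Z}_3}$-ideal is a graded ideal invariant under degree-preserving endomorphisms; $I$ consists of all polynomials vanishing on $UT_3(F)^{(-)}$ under degree-respecting substitutions. *)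

(* Defs.v *)
From HB Require Import structures.
From mathcomp Require Import all_boot all_order all_algebra.
Set Implicit Arguments. Unset Strict Implicit. Unset Printing Implicit Defensive.
Import GRing.Theory.
Local Open Scope ring_scope.

(* Variables of the free Lie algebra: (k, i) is the i-th variable of
   Z_3-degree k, i.e. y_i = (0,i), z_i = (1,i), w_i = (2,i). *)
Definition gvar := ('Z_3 * nat)%type.

Section Free.
Variable F : fieldType.

(* Formal Lie expressions; the free Lie algebra is their quotient by lie_eq. *)
Inductive term : Type :=
| TVar of gvar
| TZero
| TAdd of term & term
| TScale of F & term
| TBr of term & term.

(* The congruence generated by the axioms of Lie algebras over F:
   term / lie_eq is the free Lie algebra L over F on the variables gvar. *)
Inductive lie_eq : term -> term -> Prop :=
| le_refl a : lie_eq a a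
| le_sym a b : lie_eq a b -> lie_eq b a
| le_trans a b c : lie_eq a b -> lie_eq b c -> lie_eq a c
| le_add a a' b b' : lie_eq a a' -> lie_eq b b' -> lie_eq (TAdd a b) (TAdd a' b')
| le_scale c a a' : lie_eq a a' -> lie_eq (TScale c a) (TScale c a')
| le_br a a' b b' : lie_eq a a' -> lie_eq b b' -> lie_eq (TBr a b) (TBr a' b')
| le_addA a b c : lie_eq (TAdd a (TAdd b c)) (TAdd (TAdd a b) c)
| le_addC a b : lie_eq (TAdd a b) (TAdd b a)
| le_add0 a : lie_eq (TAdd TZero a) a
| le_addN a : lie_eq (TAdd a (TScale (-1) a)) TZero
| le_scale1 a : lie_eq (TScale 1 a) a
| le_scaleA c d a : lie_eq (TScale c (TScale d a)) (TScale (c * d) a)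
| le_scaleDl c d a : lie_eq (TScale (c + d) a) (TAdd (TScale c a) (TScale d a))
| le_scaleDr c a b : lie_eq (TScale c (TAdd a b)) (TAdd (TScale c a) (TScale c b))
| le_brDl a b c : lie_eq (TBr (TAdd a b) c) (TAdd (TBr a c) (TBr b c))
| le_brDr a b c : lie_eq (TBr a (TAdd b c)) (TAdd (TBr a b) (TBr a c))
| le_brZl k a b : lie_eq (TBr (TScale k a) b) (TScale k (TBr a b))
| le_brZr k a b : lie_eq (TBr a (TScale k b)) (TScale k (TBr a b))
| le_brxx a : lie_eq (TBr a a) TZero
| le_jacobi a b c :
    lie_eq (TAdd (TAdd (TBr a (TBr b c)) (TBr b (TBr c a))) (TBr c (TBr a b))) TZero.

(* Homogeneous component of Z_3-degree k (induced grading of L). *)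
Fixpoint proj (k : 'Z_3) (t : term) : term :=
  match t with
  | TVar x => if x.1 == k then TVar x else TZero
  | TZero => TZero
  | TAdd a b => TAdd (proj k a) (proj k b)
  | TScale c a => TScale c (proj k a)
  | TBr a b =>
      TAdd (TAdd (TBr (proj 0 a) (proj k b))
                 (TBr (proj 1 a) (proj (k - 1) b)))
           (TBr (proj 2%:R a) (proj (k - 2%:R) b))
  end.

Definition homog (k : 'Z_3) (t : term) : Prop := lie_eq (proj k t) t.

Fixpoint subst (s : gvar -> term) (t : term) : term :=
  match t with
  | TVar x => s x
  | TZero => TZero
  | TAdd a b => TAdd (subst s a) (subst s b)
  | TScale c a => TScale c (subst s a)
  | TBr a b => TBr (subst s a) (subst s b)
  end.

Definition graded_subst (s : gvar -> term) : Prop := forall x, homog x.1 (s x).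

(* J (a subset of L, given as a predicate on representatives) is a T_{Z_3}-ideal *)
Definition is_Tideal (J : term -> Prop) : Prop :=
  (forall a b, lie_eq a b -> J a -> J b) /\
  J TZero /\
  (forall a b, J a -> J b -> J (TAdd a b)) /\
  (forall c a, J a -> J (TScale c a)) /\
  (forall a b, J a -> J (TBr a b) /\ J (TBr b a)) /\
  (forall k a, J a -> J (proj k a)) /\
  (forall s a, graded_subst s -> J a -> J (subst s a)).

Definition Tgen (S : term -> Prop) (f : term) : Prop :=
  forall J, is_Tideal J -> (forall g, S g -> J g) -> J f.

Definition fin_gen_Tideal (J : term -> Prop) : Prop :=
  exists G : seq term, forall f, J f <-> Tgen (fun g => exists2 i : nat, (i < size G)%N & g = nth TZero G i) f.

Definition ut3_comp (k : 'Z_3) (A : 'M[F]_3) : Prop :=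
  forall i j : 'I_3, A i j != 0 -> (j : nat) = (i + k)%N.

Fixpoint eval (phi : gvar -> 'M[F]_3) (t : term) : 'M[F]_3 :=
  match t with
  | TVar x => phi x
  | TZero => 0
  | TAdd a b => eval phi a + eval phi b
  | TScale c a => c *: eval phi a
  | TBr a b => eval phi a *m eval phi b - eval phi b *m eval phi a
  end.

Definition graded_id_UT3 (f : term) : Prop :=
  forall phi : gvar -> 'M[F]_3, (forall x, ut3_comp x.1 (phi x)) -> eval phi f = 0.

End Free.

(* Main.v *)
(** Modulo the three identities [[y0, y1]], [[z0, w0]], [[w0, w1]] of UT_3, the free Lie
    algebra is spanned by the [y_i], the [z_i f] and [w_i f] with [f] a polynomial in the
    commuting operators [t_i = ad y_i], and the brackets [[z_i f, z_j g]].  Projecting to a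
    degree, killing variables and renaming the others, and polarizing brackets with [i = j]
    (this uses [2 != 0]), a T-ideal [J] above these identities is recovered from three spaces:
    the [f] with [z_0 f] in [J], those with [w_0 f] in [J], and the sums of [f (x) g] in
    [F[u_i, v_i]] such that the corresponding sum of [[z_0 f, z_1 g]] lies in [J].  Each is an
    ideal, stable under renaming [t_i] (hence [u_i], [v_i]) along increasing maps of indices.
    Such ideals are finitely generated up to renaming (Cohen): by Higman's lemma the leading
    monomials of a sequence of elements cannot be pairwise incomparable for divisibility up to
    an increasing renaming, so a sequence in which each element has minimal leading monomial
    outside the T-ideal generated by its predecessors must stop. *)
From Stdlib Require Import Setoid Morphisms.
From HB Require Import structures.
Require Import Defs.
From mathcomp Require Import all_boot all_order all_algebra.
From mathcomp Require Import generic_quotient boolp zify.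
Set Implicit Arguments. Unset Strict Implicit. Unset Printing Implicit Defensive.
Import GRing.Theory.

(** * Higman's lemma *)

Section Higman.
Variable T : Type.
Variable R : T -> T -> Prop.

(** Higman's order: the first word is dominated letter by letter by a scattered subword of the
    second. *)
Inductive emb : seq T -> seq T -> Prop :=
| emb_nil : emb [::] [::]
| emb_skip x w w' : emb w w' -> emb w (x :: w')
| emb_keep x y w w' : R x y -> emb w w' -> emb (x :: w) (y :: w').

Lemma emb0 w : emb [::] w.
Proof. by elim: w => [|x w IHw]; constructor. Qed.

Definition bad (f : nat -> seq T) := forall i j, i < j -> ~ emb (f i) (f j).

(** Greedy construction of Nash-Williams: each term is a shortest word by which the prefix chosen so
    far still extends to some bad sequence. *)
Lemma minimal_bad_seq f0 : bad f0 ->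
  exists2 f, bad f & forall n g, bad g -> (forall k, k < n -> g k = f k) ->
    size (f n) <= size (g n).
Proof.
move=> bad0.
pose P l := exists2 f, bad f & forall i, i < size l -> nth [::] l i = f i.
(* The hypothesis [P l] sits under the existential so that choice yields a total function [step];
   its value is arbitrary on prefixes of no bad sequence. *)
have stepP l : exists w, P l ->
    P (rcons l w) /\ forall w', P (rcons l w') -> size w <= size w'.
  have [[f bf flat]|nP] := EM (P l); last by exists [::].
  pose Q n := `[< exists2 w, P (rcons l w) & size w = n >].
  have exQ : exists n, Q n.
    exists (size (f (size l))); apply/asboolP; exists (f (size l)) => //.
    exists f => // i; rewrite size_rcons ltnS nth_rcons => il.
    by case: ltngtP il => // [/flat|->].
  case: (ex_minnP exQ) => n /asboolP[w Pw <-] minw; exists w => _; split=> // w' Pw'.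
  by apply: minw; apply/asboolP; exists w'.
have [step stepQ] := choice stepP.
pose L := fix L n := if n is m.+1 then rcons (L m) (step (L m)) else [::].
pose f n := step (L n).
have szL n : size (L n) = n by elim: n => //= n IHn; rewrite size_rcons IHn.
have nthL n k : k < n -> nth [::] (L n) k = f k.
  elim: n => //= n IHn; rewrite ltnS nth_rcons szL.
  by case: ltngtP => // [/IHn|->].
have PL n : P (L n).
  by elim: n => [|n /stepQ[]//]; exists f0.
exists f => [i j ij|n g bg gf].
  have [g bg gL] := PL j.+1; rewrite -(@nthL j.+1) ?(ltn_trans ij)// -(@nthL j.+1)//.
  by rewrite !gL ?szL ?(ltn_trans ij)//; apply: bg.
apply: (stepQ _ (PL n)).2; exists g => // i; rewrite size_rcons szL ltnS nth_rcons szL => iN.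
by case: ltngtP iN => // [iN|->//] _; rewrite nthL// gf.
Qed.

Hypothesis monotone_subseq : forall f : nat -> T, exists2 phi : nat -> nat,
  {homo phi : i j / i < j} & forall i j, i < j -> R (f (phi i)) (f (phi j)).

(** In a minimal bad sequence no word is empty. Along a subsequence with increasing heads, an
    embedding of tails would extend to the full words, so passing to the tails keeps the sequence
    bad and contradicts minimality. *)
Theorem higman (f : nat -> seq T) : exists i j, i < j /\ emb (f i) (f j).
Proof.
apply: contrapT => nf.
have {nf} : bad f by move=> i j ij fij; apply: nf; exists i, j.
case/minimal_bad_seq => {}f bf minf.
have fcons n : exists x, f n = x.1 :: x.2.
  case E: (f n) => [|a t]; last by exists (a, t).
  by case: (bf n n.+1); rewrite ?E //; apply: emb0.
have [ht htE] := choice fcons.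
have [phi phi_incr phiR] := monotone_subseq (fun n => (ht n).1).
(* The first [phi 0] terms are kept and the tails follow; at index [phi 0] the word is one letter
   shorter than in [f]. *)
pose g n := if n < phi 0 then f n else (ht (phi (n - phi 0))).2.
have phi_ge n : phi 0 <= phi n by case: n => // n; exact/ltnW/phi_incr.
have : size (f (phi 0)) <= size (g (phi 0)).
  apply: minf => [i j ij|k kp]; last by rewrite /g kp.
  rewrite /g; case: (ltnP j (phi 0)) => jp.
    by rewrite (ltn_trans ij jp); apply: bf.
  case: (ltnP i (phi 0)) => ip.
    move=> e; apply: (bf i (phi (j - phi 0))); first exact: leq_trans (phi_ge _).
    by rewrite [X in emb _ X]htE; constructor.
  have ij' : i - phi 0 < j - phi 0 by rewrite ltn_sub2rE.
  move=> e; apply: (bf (phi (i - phi 0)) (phi (j - phi 0))); first exact: phi_incr.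
  by rewrite !htE; apply: emb_keep => //; apply: phiR.
by rewrite /g ltnn subnn htE /= ltnn.
Qed.

End Higman.

(** Each next index is one past the previous at which [f] attains its minimum over all remaining
    indices. *)
Lemma nat_monotone_subseq (f : nat -> nat) : exists2 phi : nat -> nat,
  {homo phi : i j / i < j} & forall i j, i < j -> f (phi i) <= f (phi j).
Proof.
have minP N : exists k, N <= k /\ forall j, N <= j -> f k <= f j.
  pose Q n := `[< exists2 k, N <= k & f k = n >].
  have exQ : exists n, Q n by exists (f N); apply/asboolP; exists N.
  case: (ex_minnP exQ) => n /asboolP[k Nk <-] mink; exists k; split=> // j Nj.
  by apply: mink; apply/asboolP; exists j.
have [g gP] := choice minP.
pose phi := fix phi n := if n is m.+1 then g (phi m).+1 else g 0.
have phiS n : phi n < phi n.+1 by case: (gP (phi n).+1).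
have phi_incr : {homo phi : i j / i < j} by apply: homo_ltn => //; exact: ltn_trans.
exists phi => // i j ij.
have H N k : g N <= k -> f (g N) <= f k.
  by move=> gk; apply: (gP N).2; apply: leq_trans gk; case: (gP N).
by case: i ij => [|i] ij /=; apply: H; apply: ltnW; apply: (phi_incr _ _ ij).
Qed.

(** Divisibility of u^a v^b for a single index. *)
Definition lep (x y : nat * nat) := (x.1 <= y.1) && (x.2 <= y.2).

Lemma pair_monotone_subseq (f : nat -> nat * nat) : exists2 phi : nat -> nat,
  {homo phi : i j / i < j} & forall i j, i < j -> lep (f (phi i)) (f (phi j)).
Proof.
have [phi phi_incr phiR] := nat_monotone_subseq (fun n => (f n).1).
have [psi psi_incr psiR] := nat_monotone_subseq (fun n => (f (phi n)).2).
exists (phi \o psi) => [i j ij|i j ij] /=; first exact/phi_incr/psi_incr.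
by rewrite /lep psiR// phiR// psi_incr.
Qed.

Local Open Scope ring_scope.
Local Open Scope quotient_scope.

(** * The quotient of the free Lie algebra by a T-ideal *)

#[global] Instance lie_eq_equiv (F : fieldType) : Equivalence (@lie_eq F).
Proof. by split; [exact: le_refl|exact: le_sym|exact: le_trans]. Qed.
#[global] Instance TAdd_proper (F : fieldType) :
  Proper (@lie_eq F ==> @lie_eq F ==> @lie_eq F) (@TAdd F).
Proof. by move=> a a' ? b b' ?; exact: le_add. Qed.
#[global] Instance TScale_proper (F : fieldType) :
  Proper (eq ==> @lie_eq F ==> @lie_eq F) (@TScale F).
Proof. by move=> c _ <- b b' ?; exact: le_scale. Qed.
#[global] Instance TBr_proper (F : fieldType) :
  Proper (@lie_eq F ==> @lie_eq F ==> @lie_eq F) (@TBr F).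
Proof. by move=> a a' ? b b' ?; exact: le_br. Qed.

#[local] Hint Resolve le_refl : core.

(** Classical equality and choice on terms, required by generic quotients and by membership in
    sequences of terms. *)
HB.instance Definition _ (F : fieldType) := gen_eqMixin (term F).
HB.instance Definition _ (F : fieldType) := gen_choiceMixin (term F).

Section LieEq.
Variable F : fieldType.
Implicit Types a b c : term F.
Local Notation "a =l b" := (lie_eq a b) (at level 70).

Lemma lie_eqACA a b c d : TAdd (TAdd a b) (TAdd c d) =l TAdd (TAdd a c) (TAdd b d).
Proof.
by rewrite -le_addA (le_addA b c d) (le_addC b c) -(le_addA c b d) le_addA.
Qed.

Lemma lie_eq_scaleNN a : TScale (-1) (TScale (-1) a) =l a.
Proof. by rewrite le_scaleA mulrNN mulr1 le_scale1. Qed.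

Lemma lie_eq_add0r a : TAdd a (TZero F) =l a.
Proof. by rewrite le_addC le_add0. Qed.

Lemma lie_eq_scale0 a : TScale 0 a =l TZero F.
Proof.
have e : (0 : F) = 1 + -1 by rewrite subrr.
by rewrite e le_scaleDl le_scale1 le_addN.
Qed.

Lemma lie_eq_br0l a : TBr (TZero F) a =l TZero F.
Proof. by rewrite -{1}(lie_eq_scale0 a) le_brZl lie_eq_scale0. Qed.

Lemma lie_eq_br0r a : TBr a (TZero F) =l TZero F.
Proof. by rewrite -{1}(lie_eq_scale0 a) le_brZr lie_eq_scale0. Qed.

End LieEq.

Section Quotient.
Variables (F : fieldType) (K : term F -> Prop) (hK : is_Tideal K).

Let Kle a b : lie_eq a b -> K a -> K b. Proof. by case: hK => H _; exact: H. Qed.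
Let K0 : K (TZero F). Proof. by case: hK => _ []. Qed.
Let KD a b : K a -> K b -> K (TAdd a b). Proof. by case: hK => _ [_ [H _]]; exact: H. Qed.
Let KZ c a : K a -> K (TScale c a). Proof. by case: hK => _ [_ [_ [H _]]]; exact: H. Qed.
Let KB a b : K a -> K (TBr a b) /\ K (TBr b a).
Proof. by case: hK => _ [_ [_ [_ [H _]]]]; exact: H. Qed.

Definition Tdiff (a b : term F) := TAdd a (TScale (-1) b).
Definition eqmod (a b : term F) := `[< K (Tdiff a b) >].

Lemma lie_eq_mod a b : lie_eq a b -> eqmod a b.
Proof. by move=> ab; apply/asboolP; apply: Kle K0; rewrite /Tdiff ab le_addN. Qed.

Lemma eqmod_refl : reflexive eqmod.
Proof. by move=> a; apply: lie_eq_mod; apply: le_refl. Qed.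

Let eqmod_symW a b : eqmod a b -> eqmod b a.
Proof.
move/asboolP => Kab; apply/asboolP; apply: Kle (KZ (-1) Kab).
by rewrite le_scaleDr lie_eq_scaleNN le_addC.
Qed.

Lemma eqmod_sym : symmetric eqmod.
Proof. by move=> a b; apply/idP/idP; apply: eqmod_symW. Qed.

Lemma eqmod_trans : transitive eqmod.
Proof.
move=> b a c /asboolP ab /asboolP bc; apply/asboolP; apply: Kle (KD ab bc).
by rewrite /Tdiff (le_addC b) lie_eqACA (le_addC _ b) le_addN lie_eq_add0r.
Qed.

Definition eqmod_equiv := EquivRel eqmod eqmod_refl eqmod_sym eqmod_trans.

Lemma eqmod_add a a' b b' : eqmod a a' -> eqmod b b' -> eqmod (TAdd a b) (TAdd a' b').
Proof.
move=> /asboolP aa /asboolP bb; apply/asboolP; apply: Kle (KD aa bb).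
by rewrite /Tdiff lie_eqACA le_scaleDr.
Qed.

Lemma eqmod_scale c a a' : eqmod a a' -> eqmod (TScale c a) (TScale c a').
Proof.
move=> /asboolP aa; apply/asboolP; apply: Kle (KZ c aa).
by rewrite /Tdiff le_scaleDr !le_scaleA mulrC.
Qed.

Lemma eqmod_br a a' b b' : eqmod a a' -> eqmod b b' -> eqmod (TBr a b) (TBr a' b').
Proof.
move=> /asboolP aa /asboolP bb; apply: (@eqmod_trans (TBr a' b)); apply/asboolP.
  by apply: Kle (KB b aa).1; rewrite /Tdiff le_brDl le_brZl.
by apply: Kle (KB a' bb).2; rewrite /Tdiff le_brDr le_brZr.
Qed.

(** The Lie algebra of terms modulo [K]. Congruences modulo [K] become equations in an [F]-module,
    where iterated sums can be manipulated. *)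
Definition quo : Type := {eq_quot eqmod_equiv}.
HB.instance Definition _ := Choice.on quo.

Definition qpi (a : term F) : quo := \pi_({eq_quot eqmod_equiv}) a.
Let rep (x : quo) : term F := @repr _ {eq_quot eqmod_equiv} x.

Let eq_qpi a b : eqmod a b -> qpi a = qpi b.
Proof. by rewrite /qpi => ab; apply/(@eqmodP _ eqmod_equiv). Qed.
Let qpiK a : eqmod (rep (qpi a)) a.
Proof. by apply/(@eqmodP _ eqmod_equiv); rewrite reprK. Qed.
Let repK x : qpi (rep x) = x.
Proof. exact: reprK. Qed.

Lemma qpi_lie a b : lie_eq a b -> qpi a = qpi b.
Proof. by move=> ab; apply: eq_qpi; apply: lie_eq_mod. Qed.

Definition qzero := qpi (TZero F).
Definition qadd x y := qpi (TAdd (rep x) (rep y)).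
Definition qscale c x := qpi (TScale c (rep x)).
Definition br x y := qpi (TBr (rep x) (rep y)).

Let qaddE a b : qadd (qpi a) (qpi b) = qpi (TAdd a b).
Proof. by apply: eq_qpi; apply: eqmod_add; apply: qpiK. Qed.
Let qscaleE c a : qscale c (qpi a) = qpi (TScale c a).
Proof. by apply: eq_qpi; apply: eqmod_scale; apply: qpiK. Qed.
Lemma qpiB a b : qpi (TBr a b) = br (qpi a) (qpi b).
Proof. by apply/esym/eq_qpi/eqmod_br; apply: qpiK. Qed.

Lemma quoP (P : quo -> Prop) : (forall a, P (qpi a)) -> forall x, P x.
Proof. by move=> H x; rewrite -(repK x). Qed.

Let qaddA : associative qadd.
Proof.
elim/quoP=> a; elim/quoP=> b; elim/quoP=> c; rewrite !qaddE; exact/qpi_lie/le_addA.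
Qed.
Let qaddC : commutative qadd.
Proof. by elim/quoP=> a; elim/quoP=> b; rewrite !qaddE; apply/qpi_lie/le_addC. Qed.
Let qadd0 : left_id qzero qadd.
Proof. by elim/quoP=> a; rewrite !qaddE; apply/qpi_lie/le_add0. Qed.
Let qaddN : left_inverse qzero (qscale (-1)) qadd.
Proof.
by elim/quoP=> a; rewrite qscaleE !qaddE; apply: qpi_lie; rewrite le_addC le_addN.
Qed.
HB.instance Definition _ := GRing.isZmodule.Build quo qaddA qaddC qadd0 qaddN.

Let qscaleA a b x : qscale a (qscale b x) = qscale (a * b) x.
Proof. by elim/quoP: x => x; rewrite !qscaleE; apply/qpi_lie/le_scaleA. Qed.
Let qscale1 : left_id 1 qscale.
Proof. by elim/quoP=> x; rewrite !qscaleE; apply/qpi_lie/le_scale1. Qed.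
Let qscaleDr : right_distributive qscale +%R.
Proof.
move=> c; elim/quoP=> x; elim/quoP=> y.
rewrite [LHS](_ : _ = qscale c (qadd (qpi x) (qpi y)))// [RHS](_ : _ = qadd (qscale c (qpi x)) (qscale c (qpi y)))//.
by rewrite !(qaddE, qscaleE); apply/qpi_lie/le_scaleDr.
Qed.
Let qscaleDl x : {morph qscale^~ x : a b / a + b}.
Proof.
move=> a b; elim/quoP: x => x.
rewrite [RHS](_ : _ = qadd (qscale a (qpi x)) (qscale b (qpi x)))//.
by rewrite !(qaddE, qscaleE); apply/qpi_lie/le_scaleDl.
Qed.
HB.instance Definition _ :=
  GRing.Zmodule_isLmodule.Build F quo qscaleA qscale1 qscaleDr qscaleDl.

Lemma qpi0 : qpi (TZero F) = 0. Proof. by []. Qed.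
Lemma qpiD a b : qpi (TAdd a b) = qpi a + qpi b. Proof. by rewrite -qaddE. Qed.
Lemma qpiZ c a : qpi (TScale c a) = c *: qpi a. Proof. by rewrite -qscaleE. Qed.

Lemma qpi_eq0 a : K a <-> qpi a = 0.
Proof.
rewrite -qpi0; split=> [Ka|/(@eqmodP _ eqmod_equiv)/asboolP].
  apply: eq_qpi; apply/asboolP; apply: KD => //; exact: KZ.
apply: Kle; apply: le_trans (lie_eq_add0r a); apply: le_add => //.
by apply: le_trans (le_addN (TZero F)); rewrite le_add0.
Qed.

Lemma qpiP a b : qpi a = qpi b -> K a <-> K b.
Proof. by rewrite !qpi_eq0 => ->. Qed.

Lemma brDl x y z : br (x + y) z = br x z + br y z.
Proof.
elim/quoP: x => x; elim/quoP: y => y; elim/quoP: z => z.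
by rewrite -qpiD -!qpiB -qpiD; apply/qpi_lie/le_brDl.
Qed.

Lemma brDr x y z : br x (y + z) = br x y + br x z.
Proof.
elim/quoP: x => x; elim/quoP: y => y; elim/quoP: z => z.
by rewrite -qpiD -!qpiB -qpiD; apply/qpi_lie/le_brDr.
Qed.

Lemma brZl c x y : br (c *: x) y = c *: br x y.
Proof.
elim/quoP: x => x; elim/quoP: y => y.
by rewrite -qpiZ -!qpiB -qpiZ; apply/qpi_lie/le_brZl.
Qed.

Lemma brZr c x y : br x (c *: y) = c *: br x y.
Proof.
elim/quoP: x => x; elim/quoP: y => y.
by rewrite -qpiZ -!qpiB -qpiZ; apply/qpi_lie/le_brZr.
Qed.

Lemma brxx x : br x x = 0.
Proof. by elim/quoP: x => x; rewrite -qpiB -qpi0; apply/qpi_lie/le_brxx. Qed.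

Lemma br0l x : br 0 x = 0. Proof. by rewrite -[X in br X _](scale0r 0) brZl scale0r. Qed.
Lemma br0r x : br x 0 = 0. Proof. by rewrite -[X in br _ X](scale0r 0) brZr scale0r. Qed.

Lemma brC x y : br x y = - br y x.
Proof.
have := brxx (x + y); rewrite brDl !brDr !brxx add0r addr0 => /eqP.
by rewrite addr_eq0 => /eqP.
Qed.

Lemma jacobi x y z : br x (br y z) + br y (br z x) + br z (br x y) = 0.
Proof.
elim/quoP: x => x; elim/quoP: y => y; elim/quoP: z => z.
by rewrite -!qpiB -!qpiD -qpi0; apply/qpi_lie/le_jacobi.
Qed.

Lemma brNr x y : br x (- y) = - br x y.
Proof. by rewrite -scaleN1r brZr scaleN1r. Qed.

Lemma br_leibniz x y z : br (br x y) z = br (br x z) y + br x (br y z).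
Proof.
have /eqP := jacobi x y z.
rewrite (brC z x) brNr (brC y (br x z)) opprK (brC z (br x y)) subr_eq0 => /eqP <-.
by rewrite addrC.
Qed.

Lemma br_suml I (r : seq I) (P : pred I) (f : I -> quo) x :
  br (\sum_(i <- r | P i) f i) x = \sum_(i <- r | P i) br (f i) x.
Proof.
by apply: (big_morph (fun y => br y x)) => [y z|]; rewrite ?brDl ?br0l.
Qed.

Lemma br_sumr I (r : seq I) (P : pred I) (f : I -> quo) x :
  br x (\sum_(i <- r | P i) f i) = \sum_(i <- r | P i) br x (f i).
Proof.
by apply: (big_morph (fun y => br x y)) => [y z|]; rewrite ?brDr ?br0r.
Qed.

End Quotient.

(** * Leading words and finite generation *)

(* The word [(a_0, b_0) :: ... :: (a_n, b_n)] encodes the monomial prod_i u_i^a_i v_i^b_i. *)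
Notation word := (seq (nat * nat)).

Section Words.
Local Open Scope nat_scope.

Definition ltp (x y : nat * nat) := (x.1 < y.1) || (x.1 == y.1) && (x.2 < y.2).

(* Lexicographic from the last letter, on words of equal length only: trailing (0, 0)
   letters are significant, so monomials are compared after padding to one length. *)
Fixpoint ltw (s t : word) : bool :=
  match s, t with
  | x :: s', y :: t' => ltw s' t' || (s' == t') && ltp x y
  | _, _ => false
  end.

Definition addp (x y : nat * nat) := (x.1 + y.1, x.2 + y.2).

(** On monomials: the renaming of every index k with i <= k to k + 1, which leaves index i free. *)
Fixpoint insw i (w : word) : word :=
  match i, w with
  | i'.+1, x :: w' => x :: insw i' w'
  | _, _ => (0, 0) :: w
  end.

(** On monomials: multiplication by u_i^a v_i^b for [x] = (a, b), provided position [i] exists in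
    the word. *)
Fixpoint addw i x (w : word) : word :=
  match w with
  | y :: w' => if i is i'.+1 then y :: addw i' x w' else addp y x :: w'
  | [::] => [::]
  end.

Lemma ltp_trans : transitive ltp.
Proof.
move=> [a b] [c d] [e f]; rewrite /ltp /=.
case/orP=> [ca|/andP[/eqP-> bd]]; case/orP=> [ae|/andP[/eqP<- df]].
- by rewrite (ltn_trans ca ae).
- by rewrite ca.
- by rewrite ae.
- by rewrite eqxx (ltn_trans bd df) orbT.
Qed.

Lemma ltp_total x y : [|| ltp x y, x == y | ltp y x].
Proof. by case: x y => [a b] [c d]; rewrite /ltp xpair_eqE /=; do 2 case: ltngtP. Qed.

Lemma ltp_add z x y : ltp x y -> ltp (addp x z) (addp y z).
Proof. by rewrite /ltp /= ltn_add2r eqn_add2r ltn_add2r. Qed.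

Lemma ltp_wf x : Acc ltp x.
Proof.
case: x => a; elim/ltn_ind: a => a IHa; elim/ltn_ind => b IHb.
by constructor=> -[c d] /orP[/= /IHa//|/andP[/= /eqP-> /IHb]].
Qed.

Lemma ltw_size s t : ltw s t -> size s = size t.
Proof.
elim: s t => [|x s IHs] [|y t] //= /orP[/IHs->//|/andP[/eqP-> _]//].
Qed.

Lemma ltw_trans : transitive ltw.
Proof.
move=> t s u; elim: s t u => [|x s IHs] [|y t] [|z u] //=.
case/orP=> [st|/andP[/eqP-> xy]]; case/orP=> [tu|/andP[/eqP<- yz]].
- by rewrite (IHs _ _ st tu).
- by rewrite st.
- by rewrite tu.
- by rewrite eqxx (ltp_trans xy yz) orbT.
Qed.

Lemma ltw_total s t : size s = size t -> [|| ltw s t, s == t | ltw t s].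
Proof.
elim: s t => [|x s IHs] [|y t] //= [/IHs] /or3P[->|/eqP->|->]; rewrite ?orbT//.
by rewrite eqseq_cons eqxx andbT /=; case/or3P: (ltp_total x y) => ->; rewrite ?orbT.
Qed.

(** A word below [x :: w] has a smaller tail, or the same tail and a smaller head: a nested
    induction on the tail and then on the head. *)
Lemma ltw_wf w : Acc ltw w.
Proof.
elim: w => [|x w IHw]; first by constructor=> -[].
elim: IHw x => {}w _ IHw x; elim: (ltp_wf x) => {}x _ IHx; constructor=> -[//|y u] /=.
by case/orP=> [/IHw//|/andP[/eqP-> /IHx]].
Qed.

Lemma ltw_ins i s t : ltw s t -> ltw (insw i s) (insw i t).
Proof.
elim: i s t => [|i IHi] [|x s] [|y t] //=; first by move->.
by case/orP=> [/IHi->//|/andP[/eqP-> ->]]; rewrite eqxx orbT.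
Qed.

Lemma ltw_add i z s t : ltw s t -> ltw (addw i z s) (addw i z t).
Proof.
elim: i s t => [|i IHi] [|x s] [|y t] //=.
  by case/orP=> [->//|/andP[-> /ltp_add->]]; rewrite orbT.
by case/orP=> [/IHi->//|/andP[/eqP-> ->]]; rewrite eqxx orbT.
Qed.

Lemma size_ins i w : size (insw i w) = (size w).+1.
Proof. by elim: i w => [|i IHi] [|x w] //=; rewrite IHi. Qed.

Lemma size_add i z w : size (addw i z w) = size w.
Proof. by elim: i w => [|i IHi] [|x w] //=; rewrite IHi. Qed.

Lemma ins_cat s t : insw (size s) (s ++ t) = s ++ (0, 0) :: t.
Proof. by elim: s => [|x s IHs] /=; rewrite ?IHs. Qed.

Lemma add_cat s x z t : addw (size s) z (s ++ x :: t) = s ++ addp x z :: t.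
Proof. by elim: s => [|y s IHs] //=; rewrite IHs. Qed.

Lemma addpA i x y w : addw i (addp x y) w = addw i y (addw i x w).
Proof. by elim: i w => [|i IHi] [|z w] //=; rewrite ?IHi// /addp /= !addnA. Qed.

Lemma add0p i w : addw i (0, 0) w = w.
Proof. by elim: i w => [|i IHi] [|[a b] w] //=; rewrite ?IHi// /addp /= !addn0. Qed.

Lemma ltw_max n (s : seq word) : s != [::] -> all (fun w => size w == n) s ->
  exists2 m, m \in s & all (fun w => ltw w m || (w == m)) s.
Proof.
elim: s => // w s IHs _ /= /andP[/eqP wn sn].
have [->|s0] := eqVneq s [::]; first by exists w; rewrite ?mem_head//= eqxx orbT.
have [m ms mP] := IHs s0 sn.
have /ltw_total : size w = size m by rewrite wn (eqP (allP sn _ ms)).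
rewrite orbA; case/orP => [wm|mw].
  by exists m; rewrite ?in_cons ?ms ?orbT//= wm.
exists w; rewrite ?mem_head//= eqxx orbT /=; apply: sub_all mP => u /orP[um|/eqP->].
  by rewrite (ltw_trans um mw).
by rewrite mw.
Qed.

End Words.

(** * Linear combinations of terms and admissible T-ideals *)

Section Lin.
Variable F : fieldType.

(** Combinations are lists of coefficient-index pairs, with repetitions allowed, so that one list
    can be read in the quotients by several T-ideals. *)
Definition lin (T : Type) (g : T -> term F) (lc : seq (F * T)) : term F :=
  foldr (fun x t => TAdd (TScale x.1 (g x.2)) t) (TZero F) lc.

Lemma qpi_lin (K : term F -> Prop) (hK : is_Tideal K) T (g : T -> term F) lc :
  qpi hK (lin g lc) = \sum_(x <- lc) x.1 *: qpi hK (g x.2).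
Proof. by elim: lc => [|x lc IH]; rewrite ?big_nil ?big_cons //= qpiD qpiZ IH. Qed.

Lemma subst_lin s T (g : T -> term F) lc :
  subst s (lin g lc) = lin (fun m => subst s (g m)) lc.
Proof. by elim: lc => //= x lc ->. Qed.

Lemma proj_lin k T (g : T -> term F) lc :
  proj k (lin g lc) = lin (fun m => proj k (g m)) lc.
Proof. by elim: lc => //= x lc ->. Qed.

Lemma Tgen_Tideal (S : term F -> Prop) : is_Tideal (Tgen S).
Proof.
split=> [a b ab H J hJ SJ|]; first by case: (hJ) => h _; apply: h ab (H _ hJ SJ).
split=> [J hJ SJ|]; first by case: (hJ) => _ [].
split=> [a b Ha Hb J hJ SJ|].
  by case: (hJ) => _ [_ [h _]]; apply: h; [exact: Ha|exact: Hb].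
split=> [c a Ha J hJ SJ|]; first by case: (hJ) => _ [_ [_ [h _]]]; apply: h => //; exact: Ha.
split=> [a b Ha|].
  by split=> J hJ SJ; case: (hJ) => _ [_ [_ [_ [h _]]]]; case: (h a b (Ha _ hJ SJ)).
split=> [k a Ha J hJ SJ|s a sg Ha J hJ SJ].
  by case: (hJ) => _ [_ [_ [_ [_ [h _]]]]]; apply: h => //; exact: Ha.
by case: (hJ) => _ [_ [_ [_ [_ [_ h]]]]]; apply: h => //; exact: Ha.
Qed.

Definition yv i : term F := TVar F (0, i).
Definition zv i : term F := TVar F (1, i).
Definition wv i : term F := TVar F (2%:R, i).

Definition basic_ids : seq (term F) :=
  [:: TBr (yv 0) (yv 1); TBr (zv 0) (wv 0); TBr (wv 0) (wv 1)].

Definition adm (K : term F -> Prop) :=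
  is_Tideal K /\ forall g, g \in basic_ids -> K g.

Definition Tgens (G : seq (term F)) := Tgen (fun g => g \in basic_ids ++ G).

Lemma Tgens_adm G : adm (Tgens G).
Proof.
split=> [|g gi]; first exact: Tgen_Tideal.
by move=> J _; apply; rewrite mem_cat gi.
Qed.

Lemma Tgens_sub G g : g \in G -> Tgens G g.
Proof. by move=> gG J _; apply; rewrite mem_cat gG orbT. Qed.

Lemma Tgens_min G K : adm K -> (forall g, g \in G -> K g) -> forall f, Tgens G f -> K f.
Proof.
move=> [hK Ki] KG f; apply=> // g; rewrite mem_cat => /orP[]; [exact: Ki|exact: KG].
Qed.

End Lin.

(** * Noetherianity up to increasing renaming *)

Section Noetherian.
Variables (F : fieldType) (tm : word -> term F).

(** The quantification over all [K] lets one operation be applied both in [J] and in the T-ideal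
    generated by the elements found so far. *)
Definition adm_closed n (op : word -> word) := forall K, adm K ->
  forall lc : seq (F * word), all (fun x => size x.2 == n) lc ->
  K (lin tm lc) -> K (lin tm [seq (x.1, op x.2) | x <- lc]).

Hypothesis ins_closed : forall i n, (i <= n)%N -> adm_closed n (insw i).
Hypothesis add1_closed : forall i n, (i < n)%N -> adm_closed n (addw i (1, 0)%N).
Hypothesis add2_closed : forall i n, (i < n)%N -> adm_closed n (addw i (0, 1)%N).

(** Monotonicity for [ltw] ensures that the leading word of the image is the image of the leading
    word. *)
Definition good_op n n' op :=
  [/\ forall u, size u = n -> size (op u) = n',
      {homo op : u v / ltw u v} & adm_closed n op].

Lemma good_op_id n : good_op n n id.
Proof.
split=> // K _ lc _; rewrite (_ : map _ _ = lc)//.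
by rewrite -[RHS]map_id; apply: eq_map => -[].
Qed.

Lemma good_op_comp n1 n2 n3 f g : good_op n1 n2 f -> good_op n2 n3 g -> good_op n1 n3 (g \o f).
Proof.
move=> [szf hf cf] [szg hg cg]; split=> [u /szf/szg//|u v /hf/hg//|K hK lc szlc].
move/(cf _ hK _ szlc)/(cg _ hK); rewrite -map_comp; apply; rewrite all_map.
by apply: sub_all szlc => x /eqP/szf/eqP.
Qed.

Lemma good_op_ext n n' f g : f =1 g -> good_op n n' f -> good_op n n' g.
Proof. by move=> /funext->. Qed.

Lemma good_op_addw n i z : (i < n)%N -> good_op n n (addw i z).
Proof.
move=> ilt.
have g1 : good_op n n (addw i (1, 0)%N).
  split; [by move=> u <-; rewrite size_add|exact: ltw_add|exact: add1_closed].
have g2 : good_op n n (addw i (0, 1)%N).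
  split; [by move=> u <-; rewrite size_add|exact: ltw_add|exact: add2_closed].
case: z => a b; elim: a => [|a IHa].
  elim: b => [|b IHb]; first by apply: good_op_ext (good_op_id n) => w; rewrite add0p.
  by apply: good_op_ext (good_op_comp g2 IHb) => w /=; rewrite -addpA.
by apply: good_op_ext (good_op_comp g1 IHa) => w /=; rewrite -addpA.
Qed.

Lemma good_op_insw n i : (i <= n)%N -> good_op n n.+1 (insw i).
Proof.
by move=> ilt; split; [move=> u <-; rewrite size_ins|exact: ltw_ins|exact: ins_closed].
Qed.

(** An embedding decomposes into insertions of trivial letters and additions to letters. The prefix
    [pre] holds the letters already in final form, so that its size is the position to act on. *)
Lemma emb_good_op w w' : emb lep w w' -> forall pre,
  exists2 op, op (pre ++ w) = pre ++ w' & good_op (size (pre ++ w)) (size (pre ++ w')) op.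
Proof.
elim=> [|x {}w {}w' _ IH|x y {}w {}w' xy _ IH] pre.
- by exists id => //; exact: good_op_id.
- have [op opE opg] := IH (rcons pre x).
  (* A skipped letter [x] is created by inserting (0, 0) and then adding [x] to it. *)
  exists (op \o (addw (size pre) x \o insw (size pre))) => /=.
    by rewrite ins_cat add_cat -cat_rcons [addp _ _](_ : _ = x) ?opE ?cat_rcons//; case: x {opE opg}.
  rewrite !cat_rcons in opg; apply: good_op_comp opg.
  have -> : size (pre ++ x :: w) = (size (pre ++ w)).+1 by rewrite !size_cat addnS.
  apply: good_op_comp; first by apply: good_op_insw; rewrite size_cat leq_addr.
  by apply: good_op_addw; rewrite ltnS size_cat leq_addr.
- have [op opE opg] := IH (rcons pre y).
  (* The truncated differences are exact because [lep x y] holds. *)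
  exists (op \o addw (size pre) (y.1 - x.1, y.2 - x.2)%N) => /=.
    rewrite add_cat [addp _ _](_ : _ = y) -?cat_rcons ?opE//.
    by case/andP: xy => ? ?; rewrite /addp /= !subnKC// -surjective_pairing.
  rewrite !cat_rcons in opg; apply: good_op_comp opg.
  have -> : size (pre ++ y :: w) = size (pre ++ x :: w) by rewrite !size_cat.
  by apply: good_op_addw; rewrite size_cat /= addnS ltnS leq_addr.
Qed.

Variable J : term F -> Prop.
Hypothesis hJ : adm J.

Definition lead_term (it : F * word * seq (F * word)) := lin tm (it.1 :: it.2).

Definition minimal_outside G (it : F * word * seq (F * word)) :=
  [/\ J (lead_term it), ~ Tgens G (lead_term it),
      all (fun x => ltw x.2 it.1.2) it.2 &
      forall lc, all (fun x => ltw x.2 it.1.2) lc -> J (lin tm lc) -> Tgens G (lin tm lc)].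

(** Well-founded descent on a word [m] bounding all words of a combination in [J] outside the
    generated T-ideal. *)
Lemma exists_minimal_outside G n lc : all (fun x => size x.2 == n) lc ->
  J (lin tm lc) -> ~ Tgens G (lin tm lc) -> exists it, minimal_outside G it.
Proof.
have hG := Tgens_adm G.
have max_lc (lc' : seq (F * word)) k : all (fun x => size x.2 == k) lc' -> ~ Tgens G (lin tm lc') ->
    exists2 m, m \in map snd lc' & all (fun x => ltw x.2 m || (x.2 == m)) lc'.
  move=> szl nG; have [||m ml mP] := @ltw_max k (map snd lc').
  - by case: lc' nG {szl} => //= H; case: H; apply/(qpi_eq0 hG.1)/qpi0.
  - by rewrite all_map.
  - by exists m => //; rewrite all_map in mP.
move=> szl Jl nG; have [m _] := max_lc _ _ szl nG.
elim: (ltw_wf m) lc Jl nG {n szl} => {}m _ IH lc Jl nG lem.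
(* Either some outside combination uses only words below [m], and its maximal word continues the
   descent, or [m] is already minimal. *)
have [[lc' [lt' J' nG']]|nlt] := EM (exists lc', [/\ all (fun x => ltw x.2 m) lc',
    J (lin tm lc') & ~ Tgens G (lin tm lc')]).
  have [|m' /mapP[x xl ->] leq'] := max_lc lc' (size m) _ nG'.
    by apply: sub_all lt' => x /ltw_size->.
  by apply: IH leq' => //; exact: (allP lt').
(* The word [m] may occur several times in [lc]; its occurrences are merged into one leading
   term. *)
pose c := \sum_(x <- lc | x.2 == m) x.1.
pose lc' := [seq x <- lc | x.2 != m].
have linE K (hK : is_Tideal K) : qpi hK (lin tm lc) = qpi hK (lead_term (c, m, lc')).
  rewrite !qpi_lin big_cons /= (bigID (fun x => x.2 == m)) /= scaler_suml big_filter.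
  by congr (_ + _); apply: eq_bigr => x /eqP->.
exists (c, m, lc'); split=> /=.
- exact/(qpiP (linE _ hJ.1)).
- by move/(qpiP (linE _ hG.1)).
- rewrite all_filter; apply: sub_all lem => x /=.
  by case: eqVneq => //= _; rewrite orbF.
- by move=> l ll Jll; apply: contrapT => nGl; apply: nlt; exists l.
Qed.

Theorem lin_noetherian : exists2 G : seq (term F), (forall g, g \in G -> J g) &
  forall K, adm K -> (forall g, g \in G -> K g) ->
  forall n lc, all (fun x => size x.2 == n) lc -> J (lin tm lc) -> K (lin tm lc).
Proof.
apply: contrapT => nfg.
have stepP G : exists it, (forall g, g \in G -> J g) -> minimal_outside G it.
  (* A dummy value suffices when [G] is not contained in [J]. *)
  have [GJ|] := EM (forall g, g \in G -> J g); last by exists (0, [::], [::]).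
  suff [n [lc [szl Jl nG]]] : exists n lc, [/\ all (fun x => size x.2 == n) lc,
      J (lin tm lc) & ~ Tgens G (lin tm lc)].
    by have [it itP] := exists_minimal_outside szl Jl nG; exists it.
  apply: contrapT => nex; apply: nfg; exists G => // K hK KG n lc szl Jl.
  apply: (Tgens_min hK KG); apply: contrapT => nG.
  by apply: nex; exists n, lc.
have [step stepQ] := choice stepP.
pose Gs := fix Gs n := if n is m.+1 then lead_term (step (Gs m)) :: Gs m else [::].
pose f n := step (Gs n).
have GsJ n g : g \in Gs n -> J g.
  elim: n g => //= n IHn g; rewrite in_cons => /orP[/eqP->|/IHn//].
  by case: (stepQ _ IHn).
have fG i j : (i < j)%N -> lead_term (f i) \in Gs j.
  elim: j => //= j IHj; rewrite ltnS leq_eqVlt in_cons => /orP[/eqP->|/IHj->].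
    by rewrite eqxx.
  by rewrite orbT.
have fP n := stepQ _ (GsJ n).
(* Higman's lemma gives i < j for which an admissible operation carries the leading word of the i-th
   element to that of the j-th. *)
have [i [j [ij]]] := @higman _ lep pair_monotone_subseq (fun n => (f n).1.2).
move=> /emb_good_op/(_ [::]) /= [op opE [sop hop cop]].
case: (fP i) (fP j); rewrite -/(f i) -/(f j) => Ji nGi lti mini [Jj nGj ltj minj].
move: opE sop cop Ji nGi lti mini Jj nGj ltj minj (fG i j ij).
case: (f i) (f j) => [[ci mi] li] [[cj mj] lj] /= opE sop cop Ji nGi lti mini Jj nGj ltj minj fiG.
(* With a zero leading coefficient only smaller words would remain, and minimality would put the
   element in the generated T-ideal. *)
have ci0 : ci != 0.
  apply/eqP => ci0; apply: nGi.
  have E K (hK : is_Tideal K) : qpi hK (lin tm li) = qpi hK (lead_term (ci, mi, li)).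
    by rewrite !qpi_lin big_cons ci0 scale0r add0r.
  apply/(qpiP (E _ (Tgens_adm _).1)); apply: mini => //.
  exact/(qpiP (E _ hJ.1)).
have szi : all (fun x : F * word => size x.2 == size mi) ((ci, mi) :: li).
  by rewrite /= eqxx; apply: sub_all lti => x /ltw_size->.
set opi := [seq (x.1, op x.2) | x <- (ci, mi) :: li].
have Kop K : adm K -> K (lead_term (ci, mi, li)) -> K (lin tm opi).
  by move=> hK; apply: cop.
(* The j-th element minus cj / ci times the image of the i-th: the leading terms cancel. Minimality
   of the j-th element puts the difference, and hence that element itself, in the T-ideal generated
   by its predecessors. *)
pose l := lj ++ [seq (- (cj / ci) * x.1, op x.2) | x <- li].
have lE K (hK : is_Tideal K) : qpi hK (lin tm l) =
    qpi hK (lead_term (cj, mj, lj)) - (cj / ci) *: qpi hK (lin tm opi).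
  rewrite !qpi_lin /l /opi big_cat /= !big_cons !big_map /= scalerDr scalerA divfK// opE.
  rewrite opprD addrACA subrr add0r scaler_sumr -sumrN; congr (_ + _); apply: eq_bigr => x _.
  by rewrite mulNr scaleNr scalerA.
have hG := Tgens_adm (Gs j).
have Gopi : Tgens (Gs j) (lin tm opi) := Kop _ hG (Tgens_sub fiG).
have Gl : Tgens (Gs j) (lin tm l).
  apply: minj; last first.
    apply/(qpi_eq0 hJ.1); rewrite lE (qpi_eq0 hJ.1 _).1// sub0r.
    by rewrite (qpi_eq0 hJ.1 (lin tm opi)).1 ?scaler0 ?oppr0//; apply: Kop.
  rewrite /l all_cat ltj all_map -opE; apply: sub_all lti => x /=; exact: hop.
apply: nGj; apply/(qpi_eq0 hG.1).
by have := lE _ hG.1; rewrite ((qpi_eq0 hG.1 _).1 Gl) ((qpi_eq0 hG.1 _).1 Gopi) scaler0 subr0.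
Qed.

End Noetherian.

(** * Normal forms modulo the basic identities *)

Section Grading.
Variable F : fieldType.
Local Notation yv := (yv F).
Local Notation zv := (zv F).
Local Notation wv := (wv F).

(** All components are recorded, not only the k-th as in [homog], because [proj] of a bracket
    involves every component of its factors. *)
Definition ghom k (a : term F) :=
  forall j, lie_eq (proj j a) (if j == k then a else TZero F).

Lemma ghom_homog k a : ghom k a -> homog k a.
Proof. by move/(_ k); rewrite eqxx. Qed.

Lemma ghom0 k : ghom k (TZero F).
Proof. by move=> j /=; case: ifP. Qed.

Lemma ghom_var k i : ghom k (TVar F (k, i)).
Proof. by move=> j /=; rewrite eq_sym; case: ifP. Qed.

Lemma ghomD k a b : ghom k a -> ghom k b -> ghom k (TAdd a b).
Proof.
by move=> ha hb j /=; rewrite (ha j) (hb j); case: ifP => // _; rewrite le_add0.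
Qed.

Lemma Z3P (k : 'Z_3) : [\/ k = 0, k = 1 | k = 2%:R].
Proof.
case: k => [[|[|[|//]]] p]; [apply: Or31|apply: Or32|apply: Or33]; exact: val_inj.
Qed.

Lemma ghomB k l a b : ghom k a -> ghom l b -> ghom (k + l) (TBr a b).
Proof.
move=> ha hb j /=.
rewrite (ha 0) (ha 1) (ha 2%:R) (hb j) (hb (j - 1)) (hb (j - 2%:R)) !subr_eq.
rewrite (addrC k l); case: (Z3P k) => -> /=.
- rewrite !lie_eq_br0l !lie_eq_add0r addr0.
  by case: (j == l) => //; rewrite lie_eq_br0r.
- rewrite !lie_eq_br0l !lie_eq_add0r le_add0.
  by case: (j == l + 1) => //; rewrite lie_eq_br0r.
- rewrite !lie_eq_br0l !le_add0.
  by case: (j == l + 2%:R) => //; rewrite lie_eq_br0r.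
Qed.

Definition graded_map (fy fz fw : nat -> term F) (x : gvar) : term F :=
  if x.1 == 0 then fy x.2 else if x.1 == 1 then fz x.2 else fw x.2.

Lemma graded_map_graded fy fz fw : (forall i, ghom 0 (fy i)) -> (forall i, ghom 1 (fz i)) ->
  (forall i, ghom 2%:R (fw i)) -> graded_subst (graded_map fy fz fw).
Proof.
move=> hy hz hw [k i]; apply: ghom_homog; rewrite /graded_map /=.
by case: (Z3P k) => ->; [exact: hy|exact: hz|exact: hw].
Qed.

(** The head of [l] gives the outermost bracket; modulo the basic identities the order does not
    matter. *)
Definition act (l : seq nat) (t : term F) := foldr (fun j t => TBr t (yv j)) t l.

Lemma ghom_act k l t : ghom k t -> ghom k (act l t).
Proof.
by move=> ht; elim: l => //= j l IHl; rewrite -[k]addr0; apply: ghomB => //; exact: ghom_var.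
Qed.

Lemma subst_act s r l t : (forall j, s (0, j) = yv (r j)) ->
  subst s (act l t) = act (map r l) (subst s t).
Proof. by move=> sr; elim: l => //= j l ->; rewrite sr. Qed.

Lemma act_rcons l j t : act (rcons l j) t = act l (TBr t (yv j)).
Proof. by rewrite /act foldr_rcons. Qed.

(* [MY i], [MZ i l], [MW i l] and [MB i l j l'] stand for [y_i], [z_i t_l], [w_i t_l] and
   [[z_i t_l, z_j t_l']], where [t_l] is the product of the [t_k], [k] in [l]. *)
Inductive mon :=
| MY of nat
| MZ of nat & seq nat
| MW of nat & seq nat
| MB of nat & seq nat & nat & seq nat.

Definition tmon (m : mon) : term F :=
  match m with
  | MY i => yv i
  | MZ i l => act l (zv i)
  | MW i l => act l (wv i)
  | MB i l j l' => TBr (act l (zv i)) (act l' (zv j))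
  end.

Definition degm (m : mon) : 'Z_3 :=
  match m with MY _ => 0 | MZ _ _ => 1 | _ => 2%:R end.

Lemma ghom_tmon m : ghom (degm m) (tmon m).
Proof.
case: m => [i|i l|i l|i l j l'] /=; [exact: ghom_var|apply/ghom_act/ghom_var..|].
by apply: (@ghomB 1 1); apply/ghom_act/ghom_var.
Qed.

(** Multiplication table of the monomials modulo the basic identities: the empty list is a zero
    bracket, and the two-term lists come from the Leibniz rule. *)
Definition brm (a b : mon) : seq (F * mon) :=
  match a, b with
  | MY j, MZ i l => [:: (-1, MZ i (j :: l))]
  | MZ i l, MY j => [:: (1, MZ i (j :: l))]
  | MY j, MW i l => [:: (-1, MW i (j :: l))]
  | MW i l, MY j => [:: (1, MW i (j :: l))]
  | MY k, MB i l j l' => [:: (-1, MB i (k :: l) j l'); (-1, MB i l j (k :: l'))]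
  | MB i l j l', MY k => [:: (1, MB i (k :: l) j l'); (1, MB i l j (k :: l'))]
  | MZ i l, MZ j l' => [:: (1, MB i l j l')]
  | _, _ => [::]
  end.

Section Admissible.
Variables (K : term F -> Prop) (hK : adm K).
Local Notation q := (qpi hK.1).

Lemma adm_subst s a : graded_subst s -> K a -> K (subst s a).
Proof. by case: hK.1 => _ [_ [_ [_ [_ [_ h]]]]]; apply: h. Qed.

Lemma adm_proj k a : K a -> K (proj k a).
Proof. by case: hK.1 => _ [_ [_ [_ [_ [h _]]]]]; apply: h. Qed.

Lemma adm_br a b : K a -> K (TBr a b).
Proof. by case: hK.1 => _ [_ [_ [_ [h _]]]] Ka; case: (h a b Ka). Qed.

Lemma brYY i j : br (q (yv i)) (q (yv j)) = 0.
Proof.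
rewrite -qpiB; apply/qpi_eq0.
have K1 : K (TBr (yv 0) (yv 1)) by apply: hK.2; rewrite mem_head.
have gs : graded_subst (graded_map (fun k => if k == 0 then yv i else yv j)%N zv wv).
  by apply: graded_map_graded => k; try case: ifP => _; exact: ghom_var.
exact: (adm_subst gs K1).
Qed.

Lemma br12 a b : ghom 1 a -> ghom 2%:R b -> br (q a) (q b) = 0.
Proof.
move=> ha hb; rewrite -qpiB; apply/qpi_eq0.
have K2 : K (TBr (zv 0) (wv 0)) by apply: hK.2; rewrite !in_cons eqxx orbT.
have gs : graded_subst (graded_map yv (fun=> a) (fun=> b)).
  by apply: graded_map_graded => k //; exact: ghom_var.
exact: (adm_subst gs K2).
Qed.

Lemma br21 a b : ghom 1 a -> ghom 2%:R b -> br (q b) (q a) = 0.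
Proof. by move=> ha hb; rewrite brC br12 ?oppr0. Qed.

Lemma br22 a b : ghom 2%:R a -> ghom 2%:R b -> br (q a) (q b) = 0.
Proof.
move=> ha hb; rewrite -qpiB; apply/qpi_eq0.
have K3 : K (TBr (wv 0) (wv 1)) by apply: hK.2; rewrite !in_cons eqxx !orbT.
have gs : graded_subst (graded_map yv zv (fun k => if k == 0 then a else b)%N).
  by apply: graded_map_graded => k; try case: ifP => _ //; exact: ghom_var.
exact: (adm_subst gs K3).
Qed.

Definition qact (l : seq nat) x := foldr (fun j y => br y (q (yv j))) x l.

Lemma qpi_act l t : q (act l t) = qact l (q t).
Proof. by elim: l => //= j l IHl; rewrite qpiB IHl. Qed.

Lemma qactD l x y : qact l (x + y) = qact l x + qact l y.
Proof. by elim: l => //= j l ->; rewrite brDl. Qed.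

Lemma qact0 l : qact l 0 = 0.
Proof. by elim: l => //= j l ->; rewrite br0l. Qed.

(** By the Leibniz rule the operators of y_k and y_j commute up to the bracket with [y_k, y_j],
    which is zero. *)
Lemma qactC l l' x : qact l (qact l' x) = qact l' (qact l x).
Proof.
have C1 j s y : br (qact s y) (q (yv j)) = qact s (br y (q (yv j))).
  by elim: s => //= k s <-; rewrite br_leibniz brYY br0r addr0.
by elim: l => //= j l ->; rewrite C1.
Qed.

Lemma qact_perm l l' x : perm_eq l l' -> qact l x = qact l' x.
Proof.
move=> ll'; apply: (catCA_perm_ind (P := fun s => qact l x = qact s x)) ll' _ => //.
by move=> s1 s2 s3 ->; rewrite /qact !foldr_cat; exact: qactC.
Qed.

Lemma qpi_brm a b : br (q (tmon a)) (q (tmon b)) = q (lin tmon (brm a b)).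
Proof.
have hz i l : ghom 1 (act l (zv i)) by apply/ghom_act/ghom_var.
have hw i l : ghom 2%:R (act l (wv i)) by apply/ghom_act/ghom_var.
have hb i l j l' : ghom 2%:R (TBr (act l (zv i)) (act l' (zv j))) by exact: (ghom_tmon (MB i l j l')).
case: a b => [i|i l|i l|i l j l'] [i2|i2 l2|i2 l2|i2 l2 j2 l2'] /=;
  rewrite ?(qpiD, qpiZ, qpi0, addr0, scaleN1r, scale1r).
- exact: brYY.
- by rewrite qpiB brC.
- by rewrite qpiB brC.
- by rewrite !qpiB brC br_leibniz opprD.
- by rewrite qpiB.
- by rewrite qpiB.
- exact: br12.
- exact: br12.
- by rewrite qpiB.
- exact: br21.
- exact: br22.
- exact: br22.
- by rewrite !qpiB br_leibniz.
- exact: br21.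
- exact: br22.
- exact: br22.
Qed.

End Admissible.

(** One combination serves every admissible [K], so that two T-ideals can be compared on the same
    normal form. *)
Lemma normal_form t :
  exists lc, forall K (hK : adm K), qpi hK.1 t = qpi hK.1 (lin tmon lc).
Proof.
elim: t => [[k i]||a [la ha] b [lb hb]|c a [la ha]|a [la ha] b [lb hb]].
- suff [m mE] : exists m, TVar F (k, i) = tmon m.
    by exists [:: (1, m)] => K hK; rewrite qpi_lin big_seq1 scale1r mE.
  by case: (Z3P k) => ->; [exists (MY i)|exists (MZ i [::])|exists (MW i [::])].
- by exists [::].
- exists (la ++ lb) => K hK; rewrite qpiD (ha _ hK) (hb _ hK) !qpi_lin big_cat.
  by [].
- exists [seq (c * x.1, x.2) | x <- la] => K hK; rewrite qpiZ (ha _ hK) !qpi_lin big_map.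
  by rewrite scaler_sumr; apply: eq_bigr => x _; rewrite scalerA.
exists (flatten [seq flatten [seq [seq (x.1 * y.1 * z.1, z.2) | z <- brm x.2 y.2] | y <- lb] | x <- la]).
move=> K hK; rewrite qpiB (ha _ hK) (hb _ hK) !qpi_lin big_flatten big_map br_suml.
apply: eq_bigr => x _; rewrite big_flatten big_map br_sumr; apply: eq_bigr => y _.
rewrite brZl brZr qpi_brm qpi_lin scalerA scaler_sumr big_map; apply: eq_bigr => z _.
by rewrite scalerA.
Qed.

End Grading.

(** * Monomials as exponent words and as lists of indices *)

Section Flat.
Local Open Scope nat_scope.
Variable g : nat * nat -> nat.
Hypothesis gD : forall x y, g (addp x y) = g x + g y.

(** The sorted list of indices of a monomial, from index [k] on; [g] selects which exponent counts
    as the multiplicity. *)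
Fixpoint flat k (w : word) : seq nat :=
  if w is x :: w' then nseq (g x) k ++ flat k.+1 w' else [::].

Let g0 : g (0, 0) = 0.
Proof. by have : g (0, 0) = g (0, 0) + g (0, 0) := gD (0, 0) (0, 0); lia. Qed.

Lemma count_flat j k w :
  count_mem j (flat k w) = if k <= j then g (nth (0, 0) w (j - k)) else 0.
Proof.
elim: w k => [|x w IHw] k /=; first by rewrite nth_nil g0; case: ifP.
rewrite count_cat IHw count_nseq /=; case: (ltngtP k j) => [kj|kj|->].
- by rewrite mul0n add0n -(subnSK kj).
- by rewrite mul0n.
- by rewrite subnn mul1n addn0.
Qed.

Lemma map_bump_flat h k w : h <= k -> map (bump h) (flat k w) = flat k.+1 w.
Proof.
elim: w k => //= x w IHw k hk; rewrite map_cat map_nseq IHw ?(leqW hk)//.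
by rewrite /bump hk add1n.
Qed.

Lemma flat_insw i k w : i <= size w -> flat k (insw i w) = map (bump (k + i)) (flat k w).
Proof.
elim: i k w => [|i IHi] k w; first by rewrite addn0 map_bump_flat//=; case: w => [|x w] /=; rewrite g0.
case: w => //= x w iw; rewrite IHi// map_cat map_nseq addSnnS; congr (nseq _ _ ++ _).
by rewrite /bump; lia.
Qed.

Lemma flat_addw i z k w : i < size w ->
  perm_eq (flat k (addw i z w)) (nseq (g z) (k + i) ++ flat k w).
Proof.
elim: i k w => [|i IHi] k [|x w] //= iw.
  by rewrite gD addn0 catA -nseqD addnC.
by rewrite perm_sym perm_catCA perm_cat2l perm_sym -addSnnS; apply: IHi.
Qed.

End Flat.

(** Inverse of [flat] up to permutation, padded to length [n] because [ltw] compares words of equal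
    length only. *)
Definition mkword n (p : seq nat * seq nat) : word :=
  [seq (count_mem i p.1, count_mem i p.2) | i <- iota 0 n].

Lemma size_mkword n p : size (mkword n p) = n.
Proof. by rewrite size_map size_iota. Qed.

Definition bounded n (p : seq nat * seq nat) :=
  all (fun i => (i < n)%N) p.1 && all (fun i => (i < n)%N) p.2.

Lemma nth_mkword n p j : bounded n p ->
  nth (0, 0)%N (mkword n p) j = (count_mem j p.1, count_mem j p.2).
Proof.
case/andP=> /allP b1 /allP b2; case: (ltnP j n) => jn.
  by rewrite (nth_map 0)%N ?size_iota// nth_iota// add0n.
rewrite nth_default ?size_mkword//; congr (_, _); apply/esym/count_memPn/negP.
  by move/b1; rewrite ltnNge jn.
by move/b2; rewrite ltnNge jn.
Qed.

(** The elements z_0 f and w_0 f involve one family of operators; letting u_i and v_i both act as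
    t_i allows them to be indexed by the same words as the brackets. *)
Definition gsum (x : nat * nat) := (x.1 + x.2)%N.

Lemma gsumD x y : gsum (addp x y) = (gsum x + gsum y)%N.
Proof. by rewrite /gsum /addp /=; lia. Qed.
Lemma fstD x y : (addp x y).1 = (x.1 + y.1)%N. Proof. by []. Qed.
Lemma sndD x y : (addp x y).2 = (x.2 + y.2)%N. Proof. by []. Qed.

Lemma flat_mkword_sum n l : bounded n (l, [::]) -> perm_eq (flat gsum 0 (mkword n (l, [::]))) l.
Proof.
move=> b; apply/allP => j _ /=; rewrite (count_flat gsumD) leq0n subn0 nth_mkword//.
by rewrite /gsum /= addn0.
Qed.

Lemma flat_mkword1 n p : bounded n p -> perm_eq (flat fst 0 (mkword n p)) p.1.
Proof. by move=> b; apply/allP => j _ /=; rewrite (count_flat fstD) leq0n subn0 nth_mkword. Qed.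

Lemma flat_mkword2 n p : bounded n p -> perm_eq (flat snd 0 (mkword n p)) p.2.
Proof. by move=> b; apply/allP => j _ /=; rewrite (count_flat sndD) leq0n subn0 nth_mkword. Qed.

Lemma bounded_leq n n' p : (n <= n')%N -> bounded n p -> bounded n' p.
Proof.
by move=> nn /andP[/allP b1 /allP b2]; apply/andP; split; apply/allP => i;
  [move/b1|move/b2] => /= /leq_trans; apply.
Qed.

Lemma exists_bound T (f : T -> seq nat * seq nat) (s : seq T) :
  exists n, all (fun x => bounded n (f x)) s.
Proof.
have bnd l : exists n, all (fun i => (i < n)%N) l.
  exists (\max_(i <- l) i).+1; apply/allP => i il; rewrite ltnS.
  by rewrite (big_rem i il) /= leq_maxl.
elim: s => [|x s [n IH]]; first by exists 0.
have [[n1 b1] [n2 b2]] := (bnd (f x).1, bnd (f x).2).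
exists (maxn n (maxn n1 n2)) => /=; apply/andP; split.
  apply/andP; split; [apply: sub_all b1|apply: sub_all b2] => i /leq_trans; apply; lia.
by apply: sub_all IH => y; apply: bounded_leq; lia.
Qed.

(** * The three families of terms and their closure properties *)

Section Families.
Variable F : fieldType.
Local Notation yv := (yv F).
Local Notation zv := (zv F).
Local Notation wv := (wv F).

Definition tmV (v : term F) (w : word) : term F := act (flat gsum 0 w) v.
Definition tmH (w : word) : term F :=
  TBr (act (flat fst 0 w) (zv 0)) (act (flat snd 0 w) (zv 1)).

(** [Phi] realizes [op] on terms; it may be a graded substitution or a bracket with a fixed
    variable. *)
Lemma lin_closed (tm : word -> term F) n op (Phi : term F -> term F) :
  (forall K, adm K -> forall a, K a -> K (Phi a)) ->
  (forall K (hK : adm K) lc, qpi hK.1 (Phi (lin tm lc)) =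
     \sum_(x <- lc) x.1 *: qpi hK.1 (Phi (tm x.2))) ->
  (forall K (hK : adm K) w, size w = n ->
     qpi hK.1 (Phi (tm w)) = qpi hK.1 (tm (op w))) ->
  adm_closed tm n op.
Proof.
move=> KPhi Philin PhiE K hK lc szl /(KPhi K hK); apply: (qpiP (hK := hK.1) _).1.
rewrite Philin qpi_lin big_map big_seq [RHS]big_seq; apply: eq_bigr => x xl.
by rewrite PhiE//; exact/eqP/(allP szl).
Qed.

Lemma subst_closed (tm : word -> term F) n op s : graded_subst s ->
  (forall K (hK : adm K) w, size w = n ->
     qpi hK.1 (subst s (tm w)) = qpi hK.1 (tm (op w))) ->
  adm_closed tm n op.
Proof.
move=> gs; apply: lin_closed => K hK; last by move=> lc; rewrite subst_lin qpi_lin.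
by move=> a; apply: adm_subst.
Qed.

Lemma bump_map_graded i : graded_subst (graded_map (fun j => yv (bump i j)) zv wv).
Proof. by apply: graded_map_graded => j; exact: ghom_var. Qed.

Lemma tmV_ins v i n : (v = zv 0 \/ v = wv 0) -> (i <= n)%N -> adm_closed (tmV v) n (insw i).
Proof.
move=> vE iN; apply: (subst_closed (bump_map_graded i)) => K hK w wn.
rewrite /tmV (subst_act (r := bump i))// flat_insw ?wn// ?add0n; last exact: gsumD.
by case: vE => ->.
Qed.

Lemma tmV_add v i n z : gsum z = 1%N -> (i < n)%N -> adm_closed (tmV v) n (addw i z).
Proof.
move=> z1 iN; apply: (@lin_closed _ _ _ (fun a => TBr a (yv i))) => K hK.
- by move=> a; apply: adm_br.
- by move=> lc; rewrite qpiB qpi_lin br_suml; apply: eq_bigr => x _; rewrite brZl qpiB.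
move=> w wn; rewrite /tmV qpiB !qpi_act (qact_perm _ (flat_addw gsumD z 0 _)) ?wn//.
by rewrite z1 add0n.
Qed.

Lemma tmH_ins i n : (i <= n)%N -> adm_closed tmH n (insw i).
Proof.
move=> iN; apply: (subst_closed (bump_map_graded i)) => K hK w wn.
rewrite /tmH /= !(subst_act (r := bump i))//.
by rewrite (flat_insw fstD) ?wn// (flat_insw sndD) ?wn// add0n.
Qed.

(** A bracket with y_i would act on both factors by the Leibniz rule; substituting [z_0, y_i] for
    z_0 multiplies the first factor alone. *)
Lemma tmH_add1 i n : (i < n)%N -> adm_closed tmH n (addw i (1, 0)%N).
Proof.
move=> iN.
have gs : graded_subst (graded_map yv (fun j => if j == 0 then TBr (zv 0) (yv i) else zv j)%N wv).
  apply: graded_map_graded => j; try exact: ghom_var.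
  by case: ifP => _; [apply: (@ghomB _ 1 0)|]; exact: ghom_var.
apply: (subst_closed gs) => K hK w wn.
rewrite /tmH /= !(subst_act (r := id))// !map_id /= -act_rcons !qpiB !qpi_act.
congr br; apply: qact_perm; rewrite perm_sym.
  by apply: perm_trans (flat_addw fstD _ _ _) _; rewrite ?wn// add0n perm_sym perm_rcons.
by apply: perm_trans (flat_addw sndD _ _ _) _; rewrite ?wn.
Qed.

Lemma tmH_add2 i n : (i < n)%N -> adm_closed tmH n (addw i (0, 1)%N).
Proof.
move=> iN.
have gs : graded_subst (graded_map yv (fun j => if j == 1 then TBr (zv 1) (yv i) else zv j)%N wv).
  apply: graded_map_graded => j; try exact: ghom_var.
  by case: ifP => _; [apply: (@ghomB _ 1 0)|]; exact: ghom_var.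
apply: (subst_closed gs) => K hK w wn.
rewrite /tmH /= !(subst_act (r := id))// !map_id /= -act_rcons !qpiB !qpi_act.
congr br; apply: qact_perm; rewrite perm_sym.
  by apply: perm_trans (flat_addw fstD _ _ _) _; rewrite ?wn.
by apply: perm_trans (flat_addw sndD _ _ _) _; rewrite ?wn// add0n perm_sym perm_rcons.
Qed.

End Families.

(** * Reduction of a T-ideal to its components *)

Lemma eq_big_all (V : nmodType) (T : Type) (D : pred T) (s : seq T) (f g : T -> V) :
  all D s -> (forall x, D x -> f x = g x) -> \sum_(x <- s) f x = \sum_(x <- s) g x.
Proof. by move=> /all_filterP<- fg; rewrite !big_filter; apply: eq_bigr. Qed.

Section Classes.
Variable F : fieldType.
Local Notation yv := (yv F).
Local Notation zv := (zv F).
Local Notation wv := (wv F).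
Local Notation tmon := (@tmon F).

(** The type of a monomial with its [z] or [w] indices (for [MY], its [y] index). A bracket keeps
    only its unordered pair, since killing variables cannot separate [z_i f, z_j g] from
    [z_j f, z_i g]. *)
Definition mon_class (m : mon) : nat * nat * nat :=
  match m with
  | MY i => (0, i, 0)
  | MZ i _ => (1, i, 0)
  | MW i _ => (2, i, 0)
  | MB i _ j _ => (3, minn i j, maxn i j)
  end%N.

Section Filter.
Variables (K : term F -> Prop) (hK : adm K).
Local Notation q := (qpi hK.1).

Lemma qpi_lin_filter (P : pred mon) lc :
  q (lin tmon [seq x <- lc | P x.2]) = \sum_(x <- lc | P x.2) x.1 *: q (tmon x.2).
Proof. by rewrite qpi_lin big_filter. Qed.

Lemma filter_deg k lc : K (lin tmon lc) -> K (lin tmon [seq x <- lc | degm x.2 == k]).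
Proof.
move/(adm_proj hK k); rewrite proj_lin; apply: (qpiP (hK := hK.1) _).1.
rewrite qpi_lin (qpi_lin_filter (fun m => degm m == k)) [RHS]big_mkcond; apply: eq_bigr => x _.
rewrite (qpi_lie _ (ghom_tmon F x.2 k)) eq_sym; case: eqP => // _.
by rewrite qpi0 scaler0.
Qed.

(** After projection to degree [k], a substitution that fixes or kills each remaining monomial acts
    as a filter. *)
Lemma filter_subst k s (P : pred mon) lc : graded_subst s ->
  (forall m, P m -> degm m = k) ->
  (forall m, degm m = k -> q (subst s (tmon m)) = if P m then q (tmon m) else 0) ->
  K (lin tmon lc) -> K (lin tmon [seq x <- lc | P x.2]).
Proof.
move=> gs Pk sE /(filter_deg k)/(adm_subst hK gs); rewrite subst_lin.
apply: (qpiP (hK := hK.1) _).1.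
rewrite qpi_lin big_filter qpi_lin_filter big_mkcond [RHS]big_mkcond.
apply: eq_bigr => x _; case: eqP => [/sE->|nk]; first by case: ifP; rewrite ?scaler0.
by case: ifP => // /Pk.
Qed.

Definition kill (py pz pw : pred nat) : gvar -> term F :=
  graded_map (fun i => if py i then yv i else TZero F) (fun i => if pz i then zv i else TZero F)
     (fun i => if pw i then wv i else TZero F).

Lemma kill_graded py pz pw : graded_subst (kill py pz pw).
Proof. by apply: graded_map_graded => i; case: ifP => _; (exact: ghom_var || exact: ghom0). Qed.

Lemma subst_kill pz pw l t : subst (kill predT pz pw) (act l t) = act l (subst (kill predT pz pw) t).
Proof. by rewrite (subst_act (r := id))// map_id. Qed.

Lemma subst_killE py pz pw i :
  (subst (kill py pz pw) (zv i) = if pz i then zv i else TZero F) *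
  (subst (kill py pz pw) (wv i) = if pw i then wv i else TZero F).
Proof. by []. Qed.

Lemma filter_class m0 lc :
  K (lin tmon lc) -> K (lin tmon [seq x <- lc | mon_class x.2 == mon_class m0]).
Proof.
(* Setting every [w] and every [z] outside [S] to zero isolates, in degree 2, the brackets with both
   indices in [S]. *)
have KS (S : pred nat) : K (lin tmon lc) ->
    K (lin tmon [seq x <- lc | if x.2 is MB a _ b _ then S a && S b else false]).
  apply: (filter_subst (k := 2%:R) (P := fun m => if m is MB a _ b _ then S a && S b else false)
    (@kill_graded predT S pred0)).
    by case.
  case=> [//|//|i l _|i l j l' _] /=; rewrite !subst_kill !subst_killE /=.
    by rewrite qpi_act qpi0 qact0.
  rewrite !qpiB !qpi_act /=; case: (S i) => /=; last by rewrite qpi0 qact0 br0l.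
  by case: (S j) => //=; rewrite qpi0 qact0 br0r.
case: m0 => [i|i l|i l|i l j l'] Kl.
- apply: (filter_subst (k := 0) (P := fun m => mon_class m == (0, i, 0)%N)
    (@kill_graded (pred1 i) predT predT)) Kl; first by case.
  by case=> // j _; rewrite /mon_class !xpair_eqE /= andbT /kill /graded_map /=; case: ifP.
- apply: (filter_subst (k := 1) (P := fun m => mon_class m == (1, i, 0)%N)
    (@kill_graded predT (pred1 i) predT)) Kl; first by case.
  case=> //= j l' _; rewrite !xpair_eqE /= andbT subst_kill subst_killE qpi_act /=.
  by case: ifP => _; rewrite ?qpi_act// qpi0 qact0.
- apply: (filter_subst (k := 2%:R) (P := fun m => mon_class m == (2, i, 0)%N)
    (@kill_graded predT pred0 (pred1 i))) Kl; first by case.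
  case=> // [j l' _|a la b lb _] /=; rewrite !subst_kill !subst_killE ?xpair_eqE /=.
    by rewrite qpi_act andbT; case: ifP => _; rewrite ?qpi_act// qpi0 qact0.
  by rewrite qpiB !qpi_act qpi0 qact0 br0l.
have [-> {j}|ij] := eqVneq j i.
  have := KS (pred1 i) Kl; congr (K (lin _ _)); apply: eq_filter => -[c m] /=.
  by case: m => [a|a la|a la|a la b lb] //=; rewrite !xpair_eqE; lia.
have KS0 S : \sum_(x <- lc | if x.2 is MB a _ b _ then S a && S b else false)
    x.1 *: q (tmon x.2) = 0.
  by rewrite -big_filter -qpi_lin; apply/qpi_eq0/KS.
apply/(qpi_eq0 hK.1); rewrite (qpi_lin_filter (fun m => mon_class m == _)).
(* Inclusion-exclusion: brackets with indices in {i, j}, minus those using only i and those using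
   only j. *)
transitivity (\sum_(x <- lc | if x.2 is MB a _ b _ then pred2 i j a && pred2 i j b else false)
    x.1 *: q (tmon x.2)
  - (\sum_(x <- lc | if x.2 is MB a _ b _ then pred1 i a && pred1 i b else false)
    x.1 *: q (tmon x.2)
  + \sum_(x <- lc | if x.2 is MB a _ b _ then pred1 j a && pred1 j b else false)
    x.1 *: q (tmon x.2))); last by rewrite !KS0 addr0 subr0.
rewrite [LHS]big_mkcond [X in X - _]big_mkcond [X in _ - (X + _)]big_mkcond.
rewrite [X in _ - (_ + X)]big_mkcond -big_split -sumrB; apply: eq_bigr => -[c m] _ /=.
case: m => [a|a la|a la|a la b lb] //=; rewrite ?(addr0, subr0)//.
have -> : ((3, minn a b, maxn a b) == (3, minn i j, maxn i j))%N =
    (a == i) && (b == j) || (a == j) && (b == i) by rewrite !xpair_eqE; lia.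
have : ~~ ((a == i) && (a == j)) by lia.
have : ~~ ((b == i) && (b == j)) by lia.
case: (a == i); case: (a == j); case: (b == i); case: (b == j) => //= _ _;
  by rewrite ?(addr0, add0r, subr0, subrr, oppr0).
Qed.

End Filter.

(** The class of the first monomial splits off inside [J] by [filter_class], and the remaining list
    is shorter. *)
Lemma class_induction (J K : term F -> Prop) : adm J -> adm K ->
  (forall m0 lc, all (fun x => mon_class x.2 == mon_class m0) lc -> J (lin tmon lc) -> K (lin tmon lc)) ->
  forall lc, J (lin tmon lc) -> K (lin tmon lc).
Proof.
move=> hJ hK H lc; have [n] := ubnP (size lc); elim: n lc => // n IHn [_ _|[c m] lc].
  by apply/(qpi_eq0 hK.1).
move=> sz Jl; pose P (x : F * mon) := mon_class x.2 == mon_class m.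
set l := (c, m) :: lc in sz Jl *.
have splitE L (hL : adm L) : qpi hL.1 (lin tmon l) =
    qpi hL.1 (lin tmon (filter P l)) + qpi hL.1 (lin tmon (filter (predC P) l)).
  by rewrite !qpi_lin !big_filter (bigID P).
have JP : J (lin tmon (filter P l)) by exact: (filter_class hJ m Jl).
have JC : J (lin tmon (filter (predC P) l)).
  apply/(qpi_eq0 hJ.1); have := splitE _ hJ.
  by rewrite ((qpi_eq0 hJ.1 _).1 Jl) ((qpi_eq0 hJ.1 _).1 JP) add0r.
apply/(qpi_eq0 hK.1); rewrite splitE.
rewrite ((qpi_eq0 hK.1 (lin tmon (filter P l))).1 _); last first.
  by apply: H JP; exact: filter_all.
rewrite add0r; apply/(qpi_eq0 hK.1)/IHn => //.
apply: leq_ltn_trans (_ : size lc < n)%N => //.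
by rewrite /l /= {1}/P /= eqxx size_filter count_size.
Qed.

(** * Comparing two T-ideals one class at a time *)

Section Transfer.
Variables (J K : term F -> Prop) (hJ : adm J) (hK : adm K).
Variables (tm : word -> term F).
Hypothesis tmJK : forall n lc, all (fun x => size x.2 == n) lc ->
  J (lin tm lc) -> K (lin tm lc).

Definition expand (e : mon -> seq (F * word)) (lc : seq (F * mon)) : seq (F * word) :=
  flatten [seq [seq (x.1 * y.1, y.2) | y <- e x.2] | x <- lc].

Lemma qpi_expand L (hL : adm L) (g : word -> term F) e lc : qpi hL.1 (lin g (expand e lc)) =
  \sum_(x <- lc) x.1 *: (\sum_(y <- e x.2) y.1 *: qpi hL.1 (g y.2)).
Proof.
rewrite qpi_lin big_flatten big_map; apply: eq_bigr => x _; rewrite big_map scaler_sumr.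
by apply: eq_bigr => y _; rewrite scalerA.
Qed.

(** The expansion into words passes from [J] to [K] by [tmJK]; the substitution [s] then returns
    [lam] times the original combination, and [lam] is invertible. *)
Lemma transfer n e s lam (D : pred mon) lc :
  (forall m, all (fun y => size y.2 == n) (e m)) -> graded_subst s -> lam != 0 ->
  all (fun x => D x.2) lc ->
  (forall m, D m -> \sum_(y <- e m) y.1 *: qpi hK.1 (subst s (tm y.2)) =
     lam *: qpi hK.1 (tmon m)) ->
  J (lin tm (expand e lc)) -> K (lin tmon lc).
Proof.
move=> sze gs lam0 lcD eE /(tmJK (n := n)) H.
have /H/(adm_subst hK gs) : all (fun x => size x.2 == n) (expand e lc).
  by rewrite /expand; elim: (lc) => //= x t IH; rewrite all_cat IH andbT all_map; exact: sze.
rewrite subst_lin !(qpi_eq0 hK.1) qpi_expand.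
rewrite (eq_big_all (g := fun x => lam *: (x.1 *: qpi hK.1 (tmon x.2))) lcD); last first.
  by move=> x Dx; rewrite (eE _ Dx) !scalerA mulrC.
rewrite -scaler_sumr -qpi_lin => /eqP.
by rewrite scaler_eq0 (negPf lam0) => /eqP.
Qed.

End Transfer.

Definition lists (m : mon) : seq nat * seq nat :=
  match m with
  | MY _ => ([::], [::])
  | MZ _ l | MW _ l => (l, [::])
  | MB _ l _ l' => (l, l')
  end.

Section Components.
Variables (J K : term F -> Prop) (hJ : adm J) (hK : adm K).

Definition lin_sub (tm : word -> term F) := forall n lc, all (fun x => size x.2 == n) lc ->
  J (lin tm lc) -> K (lin tm lc).

(** Such a combination is a multiple c y_i; renaming y_i to y_0 shows that c = 0 or y_0 lies in
    [J]. *)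
Lemma component_y : (J (yv 0) -> K (yv 0)) -> forall i lc,
  all (fun x => mon_class x.2 == (0, i, 0)%N) lc -> J (lin tmon lc) -> K (lin tmon lc).
Proof.
move=> JKy i lc lci.
have linE L (hL : adm L) j (g : mon -> term F) : (forall k, g (MY k) = yv j) ->
    qpi hL.1 (lin g lc) = (\sum_(x <- lc) x.1) *: qpi hL.1 (yv j).
  move=> gE; rewrite qpi_lin scaler_suml; apply: eq_big_all lci _ => x.
  by case: (x.2) => //= k _; rewrite gE.
have gs j : graded_subst (graded_map (fun=> yv j) zv wv) by apply: graded_map_graded => k; exact: ghom_var.
move=> /(adm_subst hJ (gs 0%N)); rewrite subst_lin (qpi_eq0 hJ.1) (linE _ _ 0%N)// => /eqP.
have linK : qpi hK.1 (lin tmon lc) = (\sum_(x <- lc) x.1) *: qpi hK.1 (yv i).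
  rewrite qpi_lin scaler_suml; apply: eq_big_all lci _ => x.
  by case: (x.2) => //= k; rewrite !xpair_eqE /= andbT => /eqP->.
rewrite scaler_eq0 => /orP[/eqP c0|/eqP/(qpi_eq0 hJ.1) Jy].
  by apply/(qpi_eq0 hK.1); rewrite linK c0 scale0r.
have /(qpi_eq0 hK.1) y0 := adm_subst hK (gs i) (JKy Jy).
by apply/(qpi_eq0 hK.1); rewrite linK [qpi _ _]y0 scaler0.
Qed.

(** Common argument for [z] and [w]: rename the variable to index 0, pass to words of a common
    length, transfer, and rename back. *)
Lemma component_linear c (M : nat -> seq nat -> mon) (v : nat -> term F)
    (s : nat -> gvar -> term F) :
  (forall i l, tmon (M i l) = act l (v i)) -> (forall i l, lists (M i l) = (l, [::])) ->
  (forall m i, mon_class m == (c, i, 0)%N -> exists l, m = M i l) ->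
  (forall j, graded_subst (s j)) -> (forall j k, s j (0, k) = yv k) ->
  (forall j k, subst (s j) (v k) = v j) ->
  lin_sub (tmV (v 0%N)) -> forall i lc,
  all (fun x => mon_class x.2 == (c, i, 0)%N) lc -> J (lin tmon lc) -> K (lin tmon lc).
Proof.
move=> tM lM clsM gs sy sv JKv i lc lci Jl.
have [n bn] := exists_bound (fun x => lists x.2) lc.
pose D m := (mon_class m == (c, i, 0)%N) && bounded n (lists m).
have lcD : all (fun x => D x.2) lc by rewrite all_predI lci.
have DP m : D m -> exists2 l, m = M i l & bounded n (l, [::]).
  by case/andP=> /clsM[l ->]; rewrite lM; exists l.
pose e m : seq (F * word) := [:: (1, mkword n (lists m))].
apply: (transfer (hK := hK) JKv (n := n) (e := e) (D := D) _ (gs i) (oner_neq0 F) lcD).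
- by move=> m /=; rewrite size_mkword eqxx.
- move=> m /DP[l -> b]; rewrite big_seq1 /= !scale1r lM tM (subst_act (r := id))//.
  by rewrite map_id sv !qpi_act; apply: qact_perm; exact: flat_mkword_sum.
move: Jl => /(adm_subst hJ (gs 0%N)); rewrite subst_lin; apply: (qpiP (hK := hJ.1) _).1.
rewrite qpi_expand qpi_lin; apply: eq_big_all lcD _ => x /DP[l -> b].
rewrite big_seq1 /= scale1r lM tM (subst_act (r := id))// map_id sv !qpi_act.
by congr (_ *: _); apply: qact_perm; rewrite perm_sym; exact: flat_mkword_sum.
Qed.

Lemma component_z : lin_sub (tmV (zv 0)) -> forall i lc,
  all (fun x => mon_class x.2 == (1, i, 0)%N) lc -> J (lin tmon lc) -> K (lin tmon lc).
Proof.
apply: (component_linear (M := MZ) (s := fun j => graded_map yv (fun=> zv j) wv)) => //.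
  by case=> // i l k; rewrite !xpair_eqE /= andbT => /eqP->; exists l.
by move=> j; apply: graded_map_graded => k; exact: ghom_var.
Qed.

Lemma component_w : lin_sub (tmV (wv 0)) -> forall i lc,
  all (fun x => mon_class x.2 == (2, i, 0)%N) lc -> J (lin tmon lc) -> K (lin tmon lc).
Proof.
apply: (component_linear (M := MW) (s := fun j => graded_map yv zv (fun=> wv j))) => //.
  by case=> // i l k; rewrite !xpair_eqE /= andbT => /eqP->; exists l.
by move=> j; apply: graded_map_graded => k; exact: ghom_var.
Qed.

Lemma qpi_tmH L (hL : adm L) (s : gvar -> term F) n p : bounded n p ->
  (forall j, s (0, j) = yv j) ->
  qpi hL.1 (subst s (tmH F (mkword n p))) =
  br (qact p.1 (qpi hL.1 (s (1, 0%N)))) (qact p.2 (qpi hL.1 (s (1, 1%N)))).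
Proof.
move=> b sy; rewrite /tmH /= !(subst_act (r := id))// !map_id /= qpiB !qpi_act.
by rewrite (qact_perm _ (flat_mkword1 b)) (qact_perm _ (flat_mkword2 b)).
Qed.

Lemma qpi_tmH0 L (hL : adm L) n p : bounded n p ->
  qpi hL.1 (tmH F (mkword n p)) = br (qact p.1 (qpi hL.1 (zv 0))) (qact p.2 (qpi hL.1 (zv 1))).
Proof.
move=> b; rewrite /tmH qpiB !qpi_act.
by rewrite (qact_perm _ (flat_mkword1 b)) (qact_perm _ (flat_mkword2 b)).
Qed.

Lemma qpi_MB L (hL : adm L) (s : gvar -> term F) i l j l' : (forall j, s (0, j) = yv j) ->
  qpi hL.1 (subst s (tmon (MB i l j l'))) =
  br (qact l (qpi hL.1 (s (1, i)))) (qact l' (qpi hL.1 (s (1, j)))).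
Proof. by move=> sy; rewrite /= !(subst_act (r := id))// !map_id qpiB !qpi_act. Qed.

Lemma boundedC n l l' : bounded n (l, l') = bounded n (l', l).
Proof. by rewrite /bounded andbC. Qed.

Lemma component_zz_distinct : lin_sub (tmH F) -> forall i j lc, (i < j)%N ->
  all (fun x => mon_class x.2 == (3, i, j)%N) lc -> J (lin tmon lc) -> K (lin tmon lc).
Proof.
move=> JKh i j lc ij lci Jl.
have [n bn] := exists_bound (fun x => lists x.2) lc.
pose D m := (mon_class m == (3, i, j)%N) && bounded n (lists m).
have lcD : all (fun x => D x.2) lc by rewrite all_predI lci.
(* A bracket with its indices in the order (j, i) is reversed by anticommutativity, hence the sign
   and the exchanged lists. *)
pose e m : seq (F * word) := if m is MB a l b l' then
  if a == i then [:: (1, mkword n (l, l'))] else [:: (-1, mkword n (l', l))] else [::].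
have DP m : D m -> exists l l', (m = MB i l j l' \/ m = MB j l i l') /\ bounded n (l, l').
  case: m => [a|a la|a la|a la b lb] // /andP[]; rewrite !xpair_eqE /= => h bb.
  exists la, lb; split=> //.
  have [[-> ->]|[-> ->]] : (a = i /\ b = j) \/ (a = j /\ b = i) by lia.
  - by left.
  - by right.
pose back := graded_map yv (fun k => if k == 0 then zv i else zv j)%N wv.
pose forth := graded_map yv (fun k => if k == i then zv 0 else zv 1)%N wv.
have gback : graded_subst back.
  by apply: graded_map_graded => k; try case: ifP => _; exact: ghom_var.
have gforth : graded_subst forth.
  by apply: graded_map_graded => k; try case: ifP => _; exact: ghom_var.
have ji : (j == i) = false by lia.
apply: (transfer (hK := hK) JKh (n := n) (e := e) (D := D) _ gback (oner_neq0 F) lcD).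
- by case=> //= a l b l'; case: ifP => _ /=; rewrite size_mkword eqxx.
- move=> m /DP[l [l' [[->|->] b]]]; rewrite /= ?ji ?eqxx big_seq1 /= scale1r qpi_tmH ?(boundedC n l' l)//.
    by rewrite /= scale1r qpiB !qpi_act.
  by rewrite /= scaleN1r -brC qpiB !qpi_act.
move: Jl => /(adm_subst hJ gforth); rewrite subst_lin; apply: (qpiP (hK := hJ.1) _).1.
rewrite qpi_expand qpi_lin; apply: eq_big_all lcD _ => x /DP.
move=> [l [l' [[->|->] b]]]; congr (_ *: _); rewrite qpi_MB//= ?ji ?eqxx big_seq1 /=;
  rewrite qpi_tmH0 ?(boundedC n l' l)// /forth /graded_map /= ?ji ?eqxx.
  by rewrite scale1r.
by rewrite scaleN1r -brC.
Qed.

(* Here [2 != 0] is needed: setting both variables of the polarization of [X] back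
   to [z_i] returns [2 X]. *)
Lemma component_zz_equal : (2%:R : F) != 0 -> lin_sub (tmH F) -> forall i lc,
  all (fun x => mon_class x.2 == (3, i, i)%N) lc -> J (lin tmon lc) -> K (lin tmon lc).
Proof.
move=> F2 JKh i lc lci Jl.
have [n bn] := exists_bound (fun x => lists x.2) lc.
pose D m := (mon_class m == (3, i, i)%N) && bounded n (lists m).
have lcD : all (fun x => D x.2) lc by rewrite all_predI lci.
(* The polarization [z_0 f, z_1 g] + [z_1 f, z_0 g] of [z_i f, z_i g], its second bracket rewritten
   as -[z_0 g, z_1 f]. *)
pose e m : seq (F * word) := if m is MB a l b l' then
  [:: (1, mkword n (l, l')); (-1, mkword n (l', l))] else [::].
have DP m : D m -> exists l l', m = MB i l i l' /\ bounded n (l, l').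
  case: m => [a|a la|a la|a la b lb] // /andP[]; rewrite !xpair_eqE /= => h bb.
  exists la, lb; split=> //.
  by have [-> ->] : a = i /\ b = i by lia.
have gs t : ghom 1 t -> graded_subst (graded_map yv (fun=> t) wv).
  by move=> ht; apply: graded_map_graded => k //; exact: ghom_var.
have hz k : ghom 1 (zv k) by exact: ghom_var.
apply: (transfer (hK := hK) JKh (n := n) (e := e) (D := D) _ (gs _ (hz i)) F2 lcD).
- by case=> //= a l b l'; rewrite !size_mkword eqxx.
- move=> m /DP[l [l' [-> b]]]; rewrite big_cons big_seq1 /= !qpi_tmH ?(boundedC n l' l)//=.
  by rewrite scale1r scaleN1r -brC qpiB !qpi_act scaler_nat mulr2n.
have Jt t (ht : ghom 1 t) : \sum_(x <- lc) x.1 *: qpi hJ.1 (subst (graded_map yv (fun=> t) wv) (tmon x.2)) = 0.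
  have := adm_subst hJ (gs t ht) Jl.
  by rewrite subst_lin => /(qpi_eq0 hJ.1); rewrite qpi_lin.
apply/(qpi_eq0 hJ.1).
(* Polarization: the value at z_0 + z_1 minus the values at z_0 and at z_1, all three of which
   vanish modulo [J]. *)
transitivity (\sum_(x <- lc) x.1 *: qpi hJ.1 (subst (graded_map yv (fun=> TAdd (zv 0) (zv 1)) wv) (tmon x.2))
  - (\sum_(x <- lc) x.1 *: qpi hJ.1 (subst (graded_map yv (fun=> zv 0) wv) (tmon x.2))
   + \sum_(x <- lc) x.1 *: qpi hJ.1 (subst (graded_map yv (fun=> zv 1) wv) (tmon x.2)))); last first.
  by rewrite !Jt ?addr0 ?subr0//; exact: ghomD.
rewrite qpi_expand -big_split -sumrB; apply: eq_big_all lcD _ => x /DP [l [l' [-> b]]].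
rewrite /= -scalerDr -scalerBr; congr (_ *: _); rewrite !qpi_MB// /graded_map /=.
rewrite big_cons big_seq1 /= !qpi_tmH0 ?(boundedC n l' l)//= scale1r scaleN1r.
rewrite qpiD !qactD brDl !brDr -[in LHS]brC.
by rewrite [X in _ + X - _]addrC addrACA [RHS]addrAC subrr add0r.
Qed.

End Components.
End Classes.

(** * Finite generation, and the basic identities in UT_3 *)

Lemma adm_sub (F : fieldType) (J K : term F -> Prop) : (2%:R : F) != 0 ->
  adm J -> adm K -> (J (yv F 0) -> K (yv F 0)) ->
  lin_sub J K (tmV (zv F 0)) -> lin_sub J K (tmV (wv F 0)) -> lin_sub J K (tmH F) ->
  forall f, J f -> K f.
Proof.
move=> F2 hJ hK JKy JKz JKw JKh f Jf; have [lc fE] := normal_form f.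
apply/(qpiP (fE _ hK)); move/(qpiP (fE _ hJ)): Jf.
apply: class_induction => // -[i|i l|i l|i l j l'] lc'.
- exact: component_y.
- exact: component_z.
- exact: component_w.
rewrite /=; have [ij|->] : (minn i j < maxn i j)%N \/ minn i j = maxn i j by lia.
  exact: component_zz_distinct.
exact: component_zz_equal.
Qed.

Theorem adm_fin_gen (F : fieldType) (J : term F -> Prop) :
  (2%:R : F) != 0 -> adm J -> fin_gen_Tideal J.
Proof.
move=> F2 hJ.
have [Gz GzJ Gz_gen] : exists2 G : seq (term F), (forall g, g \in G -> J g) &
    forall K, adm K -> (forall g, g \in G -> K g) -> lin_sub J K (tmV (zv F 0)).
  apply: lin_noetherian => // i n; [apply: tmV_ins; by left|exact: tmV_add..].
have [Gw GwJ Gw_gen] : exists2 G : seq (term F), (forall g, g \in G -> J g) &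
    forall K, adm K -> (forall g, g \in G -> K g) -> lin_sub J K (tmV (wv F 0)).
  apply: lin_noetherian => // i n; [apply: tmV_ins; by right|exact: tmV_add..].
have [Gh GhJ Gh_gen] : exists2 G : seq (term F), (forall g, g \in G -> J g) &
    forall K, adm K -> (forall g, g \in G -> K g) -> lin_sub J K (tmH F).
  apply: lin_noetherian => // i n; [exact: tmH_ins|exact: tmH_add1|exact: tmH_add2].
(* At most one generator is needed here, namely y_0 when it belongs to [J]. *)
have [Gy GyJ Gy_gen] : exists2 G : seq (term F), (forall g, g \in G -> J g) &
    forall K : term F -> Prop, (forall g, g \in G -> K g) -> J (yv F 0) -> K (yv F 0).
  have [Jy|nJy] := EM (J (yv F 0)); last by exists [::].
  by exists [:: yv F 0] => [g|K KG _]; [rewrite inE => /eqP->|apply: KG; rewrite inE].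
pose G := basic_ids F ++ Gy ++ Gz ++ Gw ++ Gh.
have GJ g : g \in G -> J g.
  by rewrite !mem_cat => /or4P[/hJ.2|/GyJ|/GzJ|/orP[/GwJ|/GhJ]].
exists G => f; split=> [|]; last first.
  by apply=> [|_ [i iG ->]]; [exact: hJ.1|apply: GJ; exact: mem_nth].
set K := Tgen _; have KG g : g \in G -> K g.
  by move=> /(nthP (TZero F))[i iG <-] L hL; apply; exists i.
have hK : adm K.
  by split=> [|g gi]; [exact: Tgen_Tideal|apply: KG; rewrite mem_cat gi].
apply: adm_sub => //.
- by apply: Gy_gen => g gG; apply: KG; rewrite !mem_cat gG !orbT.
- by apply: Gz_gen => // g gG; apply: KG; rewrite !mem_cat gG !orbT.
- by apply: Gw_gen => // g gG; apply: KG; rewrite !mem_cat gG !orbT.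
- by apply: Gh_gen => // g gG; apply: KG; rewrite !mem_cat gG !orbT.
Qed.

(** The sum of the degrees is taken in the natural numbers, not modulo 3: a nonzero entry of the
    product would lie at least three places right of the diagonal. *)
Lemma ut3_mul0 (F : fieldType) (k l : 'Z_3) (A B : 'M[F]_3) :
  ut3_comp k A -> ut3_comp l B -> (3 <= k + l)%N -> A *m B = 0.
Proof.
move=> hA hB kl; apply/matrixP => i j; rewrite !mxE big1// => h _; apply/eqP.
rewrite mulf_eq0 -[_ || _]negbK negb_or; apply/negP => /andP[/hA hi /hB hj].
by have := ltn_ord j; lia.
Qed.

Lemma ut3_comp0E (F : fieldType) (A : 'M[F]_3) (i j : 'I_3) :
  ut3_comp 0 A -> i != j -> A i j = 0.
Proof.
move=> hA; apply: contraNeq => /hA /=; rewrite addn0 => ji.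
by apply/eqP/val_inj.
Qed.

Lemma basic_ids_graded_id (F : fieldType) g : g \in basic_ids F -> graded_id_UT3 g.
Proof.
rewrite !inE => /or3P[] /eqP-> phi hphi /=.
- have h0 := hphi (0, 0%N); have h1 := hphi (0, 1%N); apply/matrixP => i j.
  rewrite !mxE -sumrB big1// => k _.
  have [<-|ik] := eqVneq i k; last by rewrite (ut3_comp0E h0 ik) (ut3_comp0E h1 ik) !mul0r subrr.
  have [<-|ij] := eqVneq i j; first by rewrite mulrC subrr.
  by rewrite (ut3_comp0E h0 ij) (ut3_comp0E h1 ij) !mulr0 subrr.
- have h0 := hphi (1, 0%N); have h1 := hphi (2%:R, 0%N).
  by rewrite (ut3_mul0 h0 h1)// (ut3_mul0 h1 h0)// subrr.
- have h0 := hphi (2%:R, 0%N); have h1 := hphi (2%:R, 1%N).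
  by rewrite (ut3_mul0 h0 h1)// (ut3_mul0 h1 h0)// subrr.
Qed.

Theorem mainTheorem6 (F : fieldType)
  (F_infinite : forall s : seq F, exists x : F, x \notin s)
  (char_not2 : (2%:R : F) != 0)
  (J : term F -> Prop) :
  is_Tideal J ->
  (forall f, graded_id_UT3 f -> J f) ->
  fin_gen_Tideal J.
Proof.
move=> hJ IJ; apply: adm_fin_gen => //; split=> // g /basic_ids_graded_id; exact: IJ.
Qed.
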